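(* Let $d\ge 2$, let $\mathcal P$ be a uniform $(d+1)$-polytope and let $\mathcal S_{\mathcal P}$ be a polytopal sphere packing in $\widehat{\mathbb R^d}$ induced by $\mathcal P$. For every flag $(f_0,f_1,\ldots,f_d,f_{d+1}=\mathcal P)$ of $\mathcal P$, the polytopal curvatures $\kappa_{f_i}$ of $\mathcal S_{\mathcal P}$ and the canonical lengths $\ell_{f_i}$ satisfy $$(\kappa_{f_0}-\kappa_{f_1})^2+\ell_{f_2}^2(\kappa_{f_1}-\kappa_{f_2})^2+\sum_{i=2}^{d}\frac{1}{\ell_{f_{i+1}}^{-2}-\ell_{f_i}^{-2}}(\kappa_{f_i}-\kappa_{f_{i+1}})^2=\ell_{\mathcal P}^2\,\kappa_{\mathcal P}^2 .$$
   Context: Spheres. A sphere of $\widehat{\mathbb R^d}=\mathbb R^d\cup\{\infty\}$ is the image under stereographic projection (from the North Pole) of a spherical cap of the unit sphere $\mathbb S^d\subset\mathbb R^{d+1}$; it is a solid ball (positive radius), the closed exterior of a ball together with $\infty$ (negative radius), or a half-space (infinite radius). Its bend $b(S)$ is the reciprocal of its signed radius ($0$ for a half-space). Möbius transformations of $\widehat{\mathbb R^d}$ act on spheres. Polytopes. A $k$-polytope is the convex hull of finitely many points, of dimension $k$. A flag of a $(d+1)$-polytope $\mathcal P$ is a sequence of faces $(f_0,\dots,f_d,f_{d+1}=\mathcal P)$ with $\dim f_i=i$ and $f_i\subset f_{i+1}$. A polytope is regular if its group of Euclidean symmetries is transitive on flags. A $2$-polytope is uniform if it is regular; for $k>2$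 a $k$-polytope is uniform if all its facets are uniform and its symmetry group is vertex-transitive. A $k$-polytope is edge-scribed if all its edges are tangent to the unit sphere $\mathbb S^{k-1}$; it is edge-scribable if it has a combinatorially equivalent edge-scribed realisation. An edge-scribed polytope is canonical if the barycentre of the tangency points of its edges with the unit sphere is the origin. Every uniform polytope is edge-scribable, and its canonical realisation is a similar copy of it (translated and rescaled so that all edges are tangent to the unit sphere); in particular all edges of it have the same length. The canonical length $\ell_{\mathcal P}$ of a uniform polytope $\mathcal P$ is half the edge length of its canonical realisation. Faces $f_i$ ($i\ge2$) of a uniform polytope are uniform polytopes, and $\ell_{f_i}$ is the canonical length of $f_i$ regarded as an $i$-polytope in $\mathbb R^i$ (e.g. for a regular polygon, half the edge length of the regular polygon circumscribed about the unit circle). Polytopal packings. If $v\in\mathbb R^{d+1}$ with $\|v\|>1$, the stereographic sphere of $v$ is the image under stereographic projection of the cap $\{u\in\mathbb S^d: u\cdot v\ge1\}$. For an edge-scribable $(d+1)$-polytope $\mathcal P$ with canonical realisation $\mathcal P_0$, a polytopal sphere packing is $\mathcal S_{\mathcal P}=\mu\cdot\mathcal A_{\mathcal P_0}$, where $\mu$ is a Möbius transformation and $\mathcal A_{\mathcal P_0}$ is the collection of stereographic spheres of the vertices of $\mathcal P_0$. For a vertex $v$ of $\mathcal P$, $S_v\in\mathcal S_{\mathcal P}$ denotes the corresponding sphere. Polytopal curvature. For a nonempty face $f$ of $\mathcal P$ with vertex set $V(f)$, $\kappa_f:=\frac1{|V(f)|}\sum_{v\in V(f)} b(S_v)$. 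*)

(* Defs.v *)
From mathcomp Require Import all_boot all_order all_algebra finmap.
From mathcomp Require Import boolp classical_sets functions cardinality reals.

Set Implicit Arguments.
Unset Strict Implicit.
Unset Printing Implicit Defensive.

Import Order.TTheory GRing.Theory Num.Theory.

Local Open Scope classical_set_scope.
Local Open Scope ring_scope.

Section EuclideanSpace.
Variable R : realType.

Definition dot n (u v : 'rV[R]_n) : R := \sum_(i < n) u 0 i * v 0 i.

(* The norm [`|x|] of the library on ['rV[R]_n] is the sup norm. *)
Definition enorm n (u : 'rV[R]_n) : R := Num.sqrt (dot u u).

Definition edist n (x y : 'rV[R]_n) : R := enorm (x - y).

End EuclideanSpace.

Section Polytopes.
Variable R : realType.

Definition conv_hull n (s : seq 'rV[R]_n) : set 'rV[R]_n :=
  [set x | exists w : 'I_(size s) -> R,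
    [/\ forall i, 0 <= w i, \sum_i w i = 1 & x = \sum_i w i *: s`_i]].

(* [x0] and the [x0 + row i B] are k + 1 affinely independent points of [A]
   whose affine hull contains [A]. *)
Definition has_dim n (A : set 'rV[R]_n) (k : nat) : Prop :=
  exists (x0 : 'rV[R]_n) (B : 'M[R]_(k, n)),
    [/\ row_free B, A x0, forall i, A (x0 + row i B)
      & forall x, A x -> (x - x0 <= B)%MS].

Definition polytope n k (P : set 'rV[R]_n) : Prop :=
  (exists s : seq 'rV[R]_n, P = conv_hull s) /\ has_dim P k.

(* Intersections with supporting hyperplanes; [a = 0] gives [P] itself and
   the empty face. *)
Definition face n (P F : set 'rV[R]_n) : Prop :=
  exists (a : 'rV[R]_n) (c : R),
    (forall x, P x -> dot a x <= c) /\ F = [set x | P x /\ dot a x = c].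

Definition vertices n (P : set 'rV[R]_n) : set 'rV[R]_n :=
  [set v | face P [set v]].

Definition kface n k (P F : set 'rV[R]_n) : Prop := face P F /\ has_dim F k.

(* Only [f 0], ..., [f k] are meaningful. *)
Definition flag n k (P : set 'rV[R]_n) (f : nat -> set 'rV[R]_n) : Prop :=
  [/\ forall i, (i <= k)%N -> kface i P (f i),
      forall i, (i < k)%N -> f i `<=` f i.+1
    & f k = P].

(* A polytope of smaller dimension than its ambient space is treated as a
   polytope of its affine hull: every isometry of the affine hull extends to
   the ambient space. *)
Definition symmetry n (P : set 'rV[R]_n) (g : 'rV[R]_n -> 'rV[R]_n) : Prop :=
  (forall x y, edist (g x) (g y) = edist x y) /\ g @` P = P.

Definition regular n k (P : set 'rV[R]_n) : Prop :=
  forall f f', flag k P f -> flag k P f' ->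
    exists2 g, symmetry P g & forall i, (i <= k)%N -> g @` f i = f' i.

Definition vertex_transitive n (P : set 'rV[R]_n) : Prop :=
  forall u v, vertices P u -> vertices P v ->
    exists2 g, symmetry P g & g u = v.

(* Used for k >= 2 only. *)
Fixpoint uniform n k (P : set 'rV[R]_n) : Prop :=
  match k with
  | k'.+1 =>
    if (1 < k')%N then
      (forall F, kface k' P F -> uniform k' F) /\ vertex_transitive P
    else regular k P
  | 0 => regular k P
  end.

Definition edge n (P e : set 'rV[R]_n) : Prop := kface 1 P e.

Definition tangent_at n (e : set 'rV[R]_n) (p : 'rV[R]_n) : Prop :=
  [/\ e p, enorm p = 1 & forall x, e x -> dot p (x - p) = 0].

Definition edge_scribed n (P : set 'rV[R]_n) : Prop :=
  forall e, edge P e -> exists p, tangent_at e p.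

Definition tangency_points n (P : set 'rV[R]_n) : set 'rV[R]_n :=
  [set p | exists2 e, edge P e & tangent_at e p].

Definition barycentre n (A : set 'rV[R]_n) : 'rV[R]_n :=
  (#|` fset_set A|%:R : R)^-1 *: \sum_(p <- fset_set A) p.

Definition canonical n (P : set 'rV[R]_n) : Prop :=
  edge_scribed P /\ barycentre (tangency_points P) = 0.

(* [phi] is a bijection between the vertices under which the vertex sets of
   faces correspond. *)
Definition comb_equiv n m (P : set 'rV[R]_n) (Q : set 'rV[R]_m)
    (phi : 'rV[R]_n -> 'rV[R]_m) : Prop :=
  set_bij (vertices P) (vertices Q) phi /\
  forall W, W `<=` vertices P ->
    ((exists2 F, face P F & vertices F = W) <->
     (exists2 G, face Q G & vertices G = phi @` W)).

Definition similar n m (P : set 'rV[R]_n) (Q : set 'rV[R]_m)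
    (phi : 'rV[R]_n -> 'rV[R]_m) : Prop :=
  (exists2 r : R, 0 < r &
    forall x y, P x -> P y -> edist (phi x) (phi y) = r * edist x y) /\
  phi @` P = Q.

(* [Q] is the canonical realisation, in its own k-dimensional space, of the
   uniform k-polytope [P], and [phi] the correspondence between their points.
   The canonical realisation of a uniform polytope is a similar copy of it. By
   rigidity the last condition excludes nothing when k > 2, but it is needed
   when k = 2: a rhombus circumscribed about the unit circle is canonical and
   combinatorially equivalent to a square. *)
Definition canonical_realisation n k (P : set 'rV[R]_n) (Q : set 'rV[R]_k)
    (phi : 'rV[R]_n -> 'rV[R]_k) : Prop :=
  [/\ polytope k Q, comb_equiv P Q phi, canonical Q & similar P Q phi].

Definition canonical_length n k (P : set 'rV[R]_n) : R :=
  xget 0 [set l | exists (Q : set 'rV[R]_k) (phi : 'rV[R]_n -> 'rV[R]_k),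
    canonical_realisation P Q phi /\
    forall e u v, edge Q e -> vertices e u -> vertices e v -> u != v ->
      l = edist u v / 2].

End Polytopes.

Section Spheres.
Variable R : realType.

(* R^d together with the point at infinity [None]. *)
Definition ext d : Type := option 'rV[R]_d.

Definition has_bend d (S : set (ext d)) (b : R) : Prop :=
  [\/ exists (c : 'rV[R]_d) (r : R),
        [/\ 0 < r, b = r^-1 & S = Some @` [set x | edist x c <= r]],
      exists (c : 'rV[R]_d) (r : R),
        [/\ 0 < r, b = - r^-1 & S = None |` Some @` [set x | r <= edist x c]]
    | b = 0 /\ exists (a : 'rV[R]_d) (t : R),
        a != 0 /\ S = None |` Some @` [set x | dot a x <= t]].

Definition bend d (S : set (ext d)) : R := xget 0 (has_bend S).

Definition inversion d (c : 'rV[R]_d) (r : R) (x : ext d) : ext d :=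
  match x with
  | None => Some c
  | Some y => if y == c then None
              else Some (c + (r ^+ 2 / edist y c ^+ 2) *: (y - c))
  end.

Definition reflection d (a : 'rV[R]_d) (t : R) (x : ext d) : ext d :=
  match x with
  | None => None
  | Some y => Some (y - (2 * (dot a y - t) / dot a a) *: a)
  end.

Inductive mobius d : (ext d -> ext d) -> Prop :=
| mobius_id : mobius id
| mobius_inversion c r g : 0 < r -> mobius g -> mobius (inversion c r \o g)
| mobius_reflection a t g : a != 0 -> mobius g -> mobius (reflection a t \o g).

(* Stereographic projection of the unit sphere from the North Pole
   (0, ..., 0, 1) onto the equatorial hyperplane. *)
Definition stereo d (u : 'rV[R]_d.+1) : ext d :=
  if u 0 ord_max == 1 then None
  else Some (\row_(j < d) (u 0 (lift ord_max j) / (1 - u 0 ord_max))).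

Definition stereo_sphere d (v : 'rV[R]_d.+1) : set (ext d) :=
  @stereo d @` [set u | enorm u = 1 /\ 1 <= dot u v].

Definition polytopal_packing d (P : set 'rV[R]_d.+1)
    (S : 'rV[R]_d.+1 -> set (ext d)) : Prop :=
  exists (P0 : set 'rV[R]_d.+1) (phi : 'rV[R]_d.+1 -> 'rV[R]_d.+1)
      (mu : ext d -> ext d),
    [/\ canonical_realisation P P0 phi, mobius mu
      & forall v, vertices P v -> S v = mu @` stereo_sphere (phi v)].

Definition curvature d (S : 'rV[R]_d.+1 -> set (ext d))
    (F : set 'rV[R]_d.+1) : R :=
  (#|` fset_set (vertices F)|%:R)^-1 *
  \sum_(v <- fset_set (vertices F)) bend (S v).

End Spheres.

(* Main.v *)
Require Import Defs.
From mathcomp Require Import all_boot all_order all_algebra finmap.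
From mathcomp Require Import boolp classical_sets functions cardinality reals.
From mathcomp Require Import ring lra zify.

Set Implicit Arguments.
Unset Strict Implicit.
Unset Printing Implicit Defensive.

Import Order.TTheory GRing.Theory Num.Theory.
Local Open Scope classical_set_scope.
Local Open Scope ring_scope.

(** The identity is Parseval's formula in an orthogonal basis attached to the flag.

    Bends. A sphere is given by the inequality [A |x|^2 - 2 B.x + C <= 0] with
    coordinates normalised by [|B|^2 - A C = 1]; its bend is then [A], a linear
    functional that is isotropic for the dual quadratic form. Moebius
    transformations act on the coordinates by linear isometries, and the
    coordinates of the stereographic sphere of a vertex [v] with [|v|^2 = 1 + t^2]
    are affine in [v]. So there are a vector [alpha] and a number [beta] with
    [|alpha|^2 = beta^2] such that the sphere of every vertex [v] has bend
    [(alpha.v + beta) / t] ([packing_bend]).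

    Metric structure. In the canonical realisation all edges have length [2 t] and
    are touched at their midpoints, and all vertices have norm [sqrt (1 + t^2)]
    ([edge_scribed_midscribed]). Let [F_0, ..., F_(d+1)] be the flag there and
    [c_i] the barycentre of the vertices of [F_i]. By vertex transitivity [c_i] is
    equidistant from the vertices of [F_i], and so is the origin; hence [c_i] is
    the orthogonal projection of the origin on the affine hull of [F_i]
    ([flag_center_form]). Consequently the differences [c_i - c_(i+1)] are
    mutually orthogonal ([gap_orthogonal]) and
    [|c_i - c_(i+1)|^2 = |c_i|^2 - |c_(i+1)|^2] ([gap_sqr]). They are nonzero,
    since the barycentre of the vertices of a face lies on none of its proper
    faces ([gap_gt0]), so they form a basis; also [c_(d+1) = 0].

    Canonical lengths. For [i >= 2] the unit sphere meets the affine hull of [F_i]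
    in a sphere of radius [rho_i = sqrt (1 - |c_i|^2)] about [c_i], which touches
    the edges of [F_i]. Rescaling by [1 / rho_i] gives a canonical realisation of [F_i], and its
    edge length is forced, so that [l_i = t / rho_i] ([canonical_lengthE]).
    Therefore [l_(i+1)^-2 - l_i^-2 = |c_i - c_(i+1)|^2 / t^2]; likewise
    [|c_0 - c_1| = t], and [|c_1 - c_2| = t / l_2] because [|c_1| = 1].

    Averaging bends gives [kappa_i = (alpha.c_i + beta) / t]. So the terms on the
    left are the squares of the coordinates of [alpha] in the normalised basis:
    they add up to [|alpha|^2 = beta^2], which is [l_P^2 kappa_P^2] since
    [l_P = t] and [kappa_P = beta / t]. *)

(** * Inner products *)

Section Dot.
Variable R : realType.

Lemma dot_mx n (u v : 'rV[R]_n) : dot u v = (u *m v^T) 0 0.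
Proof. by rewrite mxE; apply: eq_bigr => i _; rewrite mxE. Qed.

Lemma dotC n (u v : 'rV[R]_n) : dot u v = dot v u.
Proof. by apply: eq_bigr => i _; rewrite mulrC. Qed.

Lemma dotDl n (u v w : 'rV[R]_n) : dot (u + v) w = dot u w + dot v w.
Proof. by rewrite !dot_mx mulmxDl mxE. Qed.

Lemma dotDr n (u v w : 'rV[R]_n) : dot w (u + v) = dot w u + dot w v.
Proof. by rewrite dotC dotDl !(dotC w). Qed.

Lemma dotZl n a (u w : 'rV[R]_n) : dot (a *: u) w = a * dot u w.
Proof. by rewrite !dot_mx -scalemxAl mxE. Qed.

Lemma dotZr n a (u w : 'rV[R]_n) : dot w (a *: u) = a * dot w u.
Proof. by rewrite dotC dotZl dotC. Qed.

Lemma dotNl n (u w : 'rV[R]_n) : dot (- u) w = - dot u w.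
Proof. by rewrite -scaleN1r dotZl mulN1r. Qed.

Lemma dotNr n (u w : 'rV[R]_n) : dot w (- u) = - dot w u.
Proof. by rewrite dotC dotNl dotC. Qed.

Lemma dot0l n (w : 'rV[R]_n) : dot 0 w = 0.
Proof. by rewrite -(scale0r w) dotZl mul0r. Qed.

Lemma dot0r n (w : 'rV[R]_n) : dot w 0 = 0.
Proof. by rewrite dotC dot0l. Qed.

Definition dotE := (dotDl, dotDr, dotNl, dotNr, dotZl, dotZr, dot0l, dot0r).

Lemma dot_sumr n (I : Type) (r : seq I) (p : pred I) (F : I -> 'rV[R]_n) u :
  dot u (\sum_(i <- r | p i) F i) = \sum_(i <- r | p i) dot u (F i).
Proof.
exact: (big_morph (dot u) (fun x y => dotDr x y u) (dot0r u)).
Qed.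

Lemma dot_ge0 n (u : 'rV[R]_n) : 0 <= dot u u.
Proof. by apply: sumr_ge0 => i _; rewrite -expr2 sqr_ge0. Qed.

Lemma dot_eq0 n (u : 'rV[R]_n) : (dot u u == 0) = (u == 0).
Proof.
apply/idP/eqP => [|->]; last by rewrite dot0l.
rewrite /dot psumr_eq0 => [/allP u0|i _]; last by rewrite -expr2 sqr_ge0.
apply/rowP => i; rewrite mxE; have := u0 i (mem_index_enum i).
by rewrite -expr2 sqrf_eq0 => /eqP.
Qed.

Lemma dot_gt0 n (u : 'rV[R]_n) : (0 < dot u u) = (u != 0).
Proof. by rewrite lt0r dot_eq0 dot_ge0 andbT. Qed.

Lemma enorm_ge0 n (u : 'rV[R]_n) : 0 <= enorm u.
Proof. exact: sqrtr_ge0. Qed.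

Lemma enorm_sqr n (u : 'rV[R]_n) : enorm u ^+ 2 = dot u u.
Proof. by rewrite sqr_sqrtr ?dot_ge0. Qed.

Lemma edist_ge0 n (x y : 'rV[R]_n) : 0 <= edist x y.
Proof. exact: sqrtr_ge0. Qed.

Lemma edist_sqr n (x y : 'rV[R]_n) : edist x y ^+ 2 = dot (x - y) (x - y).
Proof. exact: enorm_sqr. Qed.

Lemma edist_eq0 n (x y : 'rV[R]_n) : (edist x y == 0) = (x == y).
Proof. by rewrite -sqrf_eq0 edist_sqr dot_eq0 subr_eq0. Qed.

Lemma edist_gt0 n (x y : 'rV[R]_n) : (0 < edist x y) = (x != y).
Proof. by rewrite lt0r edist_eq0 edist_ge0 andbT. Qed.

Lemma edistC n (x y : 'rV[R]_n) : edist x y = edist y x.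
Proof. by rewrite /edist /enorm -opprB dotNl dotNr opprK. Qed.

Lemma edistxx n (x : 'rV[R]_n) : edist x x = 0.
Proof. by apply/eqP; rewrite edist_eq0. Qed.

Lemma eqr_sqr (x y : R) : 0 <= x -> 0 <= y -> x ^+ 2 = y ^+ 2 -> x = y.
Proof. by move=> x0 y0 /eqP; rewrite eqrXn2 // => /eqP. Qed.

(** The cokernel of [V] has a column that does not annihilate [x]; multiplied by its
    value at [x] it becomes positive there. *)
Lemma separating_form n m (V : 'M[R]_(m, n)) (x : 'rV[R]_n) :
  ~~ (x <= V)%MS ->
  exists b, (forall y : 'rV[R]_n, (y <= V)%MS -> dot b y = 0) /\ 0 < dot b x.
Proof.
move=> xV.
have : x *m cokermx V != 0 by rewrite -submxE.
move=> /rV0Pn [j xj]; set w := row j (cokermx V)^T.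
have wE (y : 'rV[R]_n) : dot w y = (y *m cokermx V) 0 j.
  by rewrite dotC /dot mxE; apply: eq_bigr => i _; rewrite !mxE.
exists ((x *m cokermx V) 0 j *: w); split => [y|].
  rewrite submxE => /eqP y0.
  by rewrite dotZl wE y0 [X in _ * X]mxE mulr0.
by rewrite dotZl wE -expr2 exprn_even_gt0.
Qed.

End Dot.

(** * Convex hulls and their faces *)

Section Hulls.
Variable R : realType.
Implicit Types n k : nat.

(** The convexity half of [polytope]: it is kept apart from the dimension since
    faces inherit it whether or not they are empty. *)
Definition is_hull n (P : set 'rV[R]_n) := exists s, P = conv_hull s.

Lemma mem_hull n (s : seq 'rV[R]_n) x : x \in s -> conv_hull s x.
Proof.
move=> xs; have xs' := xs; rewrite -index_mem in xs'.
exists (fun i => (i == Ordinal xs')%:R); split => [i||].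
- exact: ler0n.
- by rewrite (bigD1 (Ordinal xs')) //= eqxx big1 ?addr0 // => i /negbTE ->.
- rewrite (bigD1 (Ordinal xs')) //= eqxx scale1r big1 ?addr0 ?nth_index //.
  by move=> i /negbTE ->; rewrite scale0r.
Qed.

Lemma hull_le n (s : seq 'rV[R]_n) a c :
  (forall x, x \in s -> dot a x <= c) -> forall x, conv_hull s x -> dot a x <= c.
Proof.
move=> sc x [w [w0 w1 ->]]; rewrite dot_sumr -[c]mul1r -w1 mulr_suml.
apply: ler_sum => i _; rewrite dotZr ler_wpM2l //.
by apply: sc; rewrite mem_nth.
Qed.

Lemma hull_inhabited n (s : seq 'rV[R]_n) x :
  conv_hull s x -> exists y, y \in s.
Proof.
case: s => [|y s _]; last by exists y; rewrite mem_head.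
by case=> w [_ /eqP]; rewrite big_ord0 eq_sym oner_eq0.
Qed.

Lemma seq_argmax (T : eqType) (h : T -> R) (s : seq T) y0 : y0 \in s ->
  exists2 y, y \in s & forall x, x \in s -> h x <= h y.
Proof.
elim: s y0 => // z s IH y0 _; case: s IH => [_|y s /(_ y (mem_head _ _)) [m ms mM]].
  by exists z; rewrite ?mem_head // => x; rewrite inE => /eqP ->.
have [zm|/ltW mz] := leP (h z) (h m).
  exists m; first by rewrite inE ms orbT.
  by move=> x; rewrite inE => /predU1P[->//|/mM].
exists z; first by rewrite mem_head.
by move=> x; rewrite inE => /predU1P[->//|/mM /le_trans]; apply.
Qed.

(** Among the convex combinations of the generators, those that reach the
    maximum of a linear form put no weight on the other generators. *)
Lemma face_hull_filter n (s : seq 'rV[R]_n) a c :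
  (forall x, x \in s -> dot a x <= c) ->
  [set x | conv_hull s x /\ dot a x = c]
    = conv_hull [seq x <- s | dot a x == c].
Proof.
move=> sc; apply/seteqP; split => [x [[w [w0 w1 xE]] axc]|x].
  have supp i : w i != 0 -> dot a s`_i = c.
    move=> wi0; apply/eqP; rewrite -subr_eq0.
    have S0 : \sum_i w i * (c - dot a s`_i) = 0.
      rewrite -[RHS](subrr c) -{3}axc xE dot_sumr -[in RHS](mul1r c) -w1.
      rewrite mulr_suml -sumrB; apply: eq_bigr => j _.
      by rewrite dotZr mulrBr.
    have T j : 0 <= w j * (c - dot a s`_j).
      by rewrite mulr_ge0 // subr_ge0 sc // mem_nth.
    move/eqP: S0; rewrite psumr_eq0 // => /allP /(_ i (mem_index_enum i)).
    by rewrite mulf_eq0 (negbTE wi0) /= -oppr_eq0 opprB.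
  (* The points of [s] may be repeated, so the weights of equal ones are added. *)
  set s' := [seq _ <- _ | _].
  pose v (j : 'I_(size s')) := \sum_(i < size s | index s`_i s' == j) w i.
  have in_s' (i : 'I_(size s)) : w i != 0 -> (index (nth 0%R s i) s' < size s')%N.
    by move=> /supp wi; rewrite index_mem mem_filter wi eqxx mem_nth.
  have reidx (T : nmodType) (F : 'I_(size s) -> T) :
      (forall i, w i = 0 -> F i = 0) ->
      \sum_i F i = \sum_(j < size s') \sum_(i < size s | index s`_i s' == j) F i.
    move=> F0; rewrite (bigID (fun i => w i != 0)) /=.
    rewrite [X in _ + X]big1 ?addr0; last by move=> i /negPn/eqP/F0.
    under [RHS]eq_bigr => j _.
      rewrite (bigID (fun i => w i != 0)) /=.
      rewrite [X in _ + X]big1 ?addr0; last by move=> i /andP[_ /negPn/eqP/F0].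
      over.
    rewrite (exchange_big_dep (fun i => w i != 0)) /=; last by move=> j i _ /andP[].
    apply: eq_bigr => i wi.
    rewrite (big_pred1 (Ordinal (in_s' i wi))) // => j /=.
    by rewrite wi andbT -val_eqE /= eq_sym.
  exists v; split => [j||].
  - exact: sumr_ge0.
  - by rewrite -w1 [RHS]reidx.
  - rewrite xE reidx; last by move=> i ->; rewrite scale0r.
    apply: eq_bigr => j _; rewrite scaler_suml; apply: eq_bigr => i /eqP <-.
    have [->|wi0] := eqVneq (w i) 0; first by rewrite !scale0r.
    by rewrite nth_index // -index_mem in_s'.
have le1 : forall y, conv_hull [seq x <- s | dot a x == c] y -> dot a y <= c.
  by apply: hull_le => y; rewrite mem_filter => /andP[/eqP ->].
have ge1 : forall y, conv_hull [seq x <- s | dot a x == c] y ->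
    dot (- a) y <= - c.
  by apply: hull_le => y; rewrite mem_filter => /andP[/eqP <-]; rewrite dotNl.
move=> hx; split; last first.
  by apply: le_anti; rewrite le1 //=; have := ge1 _ hx; rewrite dotNl lerN2.
have {hx} [w [w0 w1 xE]] := hx; move: w w0 w1 xE.
set s' := [seq _ <- _ | _] => w w0 w1 xE.
have lts (j : 'I_(size s')) : (index (nth 0%R s' j) s < size s)%N.
  rewrite index_mem; have : s'`_j \in s' by rewrite mem_nth.
  by rewrite mem_filter => /andP[].
pose h j := Ordinal (lts j).
have hE (T : nmodType) (F : 'I_(size s') -> T) :
    \sum_j F j = \sum_i \sum_(j | h j == i) F j.
  by rewrite (partition_big h xpredT).
exists (fun i => \sum_(j | h j == i) w j); split => [i||].
- exact: sumr_ge0.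
- by rewrite -hE.
- rewrite xE hE; apply: eq_bigr => i _; rewrite scaler_suml.
  apply: eq_bigr => j /eqP <- /=; rewrite nth_index // -index_mem lts //.
Qed.

Lemma face_hull n (P F : set 'rV[R]_n) : is_hull P -> face P F -> is_hull F.
Proof.
move=> [s ->] [a [c [ac ->]]]; exists [seq x <- s | dot a x == c].
by apply: face_hull_filter => x /mem_hull/ac.
Qed.

Lemma face_sub n (P F : set 'rV[R]_n) : face P F -> F `<=` P.
Proof. by move=> [a [c [_ ->]]] x []. Qed.

Lemma face_refl n (P : set 'rV[R]_n) : face P P.
Proof.
exists 0, 0; split=> [x _|]; first by rewrite dot0l.
by apply/seteqP; split => [x Px|x []//]; rewrite /= dot0l.
Qed.

Lemma face_restrict n (P F G : set 'rV[R]_n) :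
  face P G -> G `<=` F -> F `<=` P -> face F G.
Proof.
move=> [a [c [ac ->]]] GF FP; exists a, c; split=> [x /FP/ac//|].
apply/seteqP; split => [x [Px xc]|x [Fx xc]] /=; last by split => //; apply: FP.
by split => //; apply: GF.
Qed.

(** Faces of a face are exposed in the whole hull by adding to their own form
    a large multiple of the form exposing the intermediate face. A finite
    multiple suffices because there are finitely many generators. *)
Lemma face_trans n (P F G : set 'rV[R]_n) :
  is_hull P -> face P F -> face F G -> face P G.
Proof.
move=> [s ->] [a [c [ac ->]]] [b [e [be ->]]].
have [N [N0 HN]] : exists N : R, 0 <= N /\
    forall x, x \in s -> dot b x - e <= N * (c - dot a x).
  have {ac be} : forall x, x \in s ->
      dot a x <= c /\ (dot a x = c -> dot b x <= e).
    by move=> x /mem_hull sx; split=> [|xc]; [apply: ac|apply: be].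
  elim: s => [_|z s IH zs]; first by exists 0; split.
  case: IH => [x xs|N [N0 HN]]; first by apply: zs; rewrite inE xs orbT.
  have [za zb] := zs z (mem_head _ _).
  have [M [M0 HM]] : exists M, 0 <= M /\ dot b z - e <= M * (c - dot a z).
    have [/zb bz|nz] := eqVneq (dot a z) c.
      by exists 0; rewrite mul0r subr_le0.
    have lz : 0 < c - dot a z by rewrite subr_gt0 lt_neqAle nz.
    exists (`|dot b z - e| / (c - dot a z)); split.
      by rewrite divr_ge0 // ltW.
    by rewrite divfK ?gt_eqF // ler_norm.
  exists (N + M); split; first exact: addr_ge0.
  move=> x; rewrite inE => /predU1P[->|xs].
    by rewrite mulrDl (le_trans HM) // lerDr mulr_ge0 // subr_ge0.
  rewrite mulrDl (le_trans (HN _ xs)) // lerDl mulr_ge0 // subr_ge0.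
  by case: (zs x) => //; rewrite inE xs orbT.
have H x : conv_hull s x -> dot b x - e <= N * (c - dot a x).
  have H y : y \in s -> dot (b + N *: a) y <= N * c + e.
    by move=> /HN; rewrite dotDl dotZl; lra.
  by move/(hull_le H); rewrite dotDl dotZl; lra.
(* [N] makes the form valid; one more [a] makes it strict outside the face. *)
exists ((N + 1) *: a + b), ((N + 1) * c + e); split=> [x sx|].
  by have := H x sx; have := ac x sx; rewrite dotDl dotZl; lra.
apply/seteqP; split => [x [[sx xc] xe]|x [sx]] /=.
  by split=> //; rewrite dotDl dotZl xc xe.
rewrite dotDl dotZl => xE; have := H x sx; have := ac x sx => h1 h2.
have xc : dot a x = c by lra.
by split; [split|]; rewrite ?xc //; move: xE; rewrite xc; lra.
Qed.

End Hulls.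

(** * Dimension and vertices *)

Section Dimension.
Variable R : realType.
Implicit Types n k : nat.

Lemma dot_span n m (B : 'M[R]_(m, n)) a (y : 'rV[R]_n) :
  (forall i, dot a (row i B) = 0) -> (y <= B)%MS -> dot a y = 0.
Proof.
move=> aB /submxP[w ->]; rewrite mulmx_sum_row dot_sumr big1 // => i _.
by rewrite dotZr aB mulr0.
Qed.

Lemma has_dim_inhabited n (A : set 'rV[R]_n) k : has_dim A k -> A !=set0.
Proof. by move=> [x0 [B [_ Ax0 _ _]]]; exists x0. Qed.

Lemma has_dim_rank_le n (A : set 'rV[R]_n) k m (V : 'M[R]_(m, n)) x1 :
  has_dim A k -> (forall x, A x -> (x - x1 <= V)%MS) -> (k <= \rank V)%N.
Proof.
move=> [x0 [B [/eqP Bk Ax0 AB _]]] AV; rewrite -[X in (X <= _)%N]Bk.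
apply/mxrankS/row_subP => i.
have -> : row i B = (x0 + row i B - x1) - (x0 - x1).
  by rewrite opprB addrA subrK addrAC subrr add0r.
by rewrite addmx_sub ?eqmx_opp ?AV.
Qed.

Lemma has_dim_le n (A A' : set 'rV[R]_n) k k' :
  has_dim A k -> has_dim A' k' -> A `<=` A' -> (k <= k')%N.
Proof.
move=> dA [x0 [B [/eqP Bk _ _ AB]]] AA'.
rewrite -[X in (_ <= X)%N]Bk; apply: (has_dim_rank_le (x1 := x0) dA).
by move=> x /AA'/AB.
Qed.

Lemma has_dim_uniq n (A : set 'rV[R]_n) k k' :
  has_dim A k -> has_dim A k' -> k = k'.
Proof.
by move=> dk dk'; apply/anti_leq; rewrite (has_dim_le dk dk') ?(has_dim_le dk' dk).
Qed.

(** A linearly independent family of differences of maximal size spans. *)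
Lemma has_dim_exists n (A : set 'rV[R]_n) : A !=set0 -> exists k, has_dim A k.
Proof.
move=> [x0 Ax0].
pose Q k := exists B : 'M[R]_(k, n), row_free B /\ forall i, A (x0 + row i B).
have exQ : exists k, `[< Q k >].
  exists 0%N; apply/asboolP; exists 0; split; last by case.
  by rewrite /row_free mxrank0.
have ubQ k : `[< Q k >] -> (k <= n)%N.
  by move=> /asboolP[B [/eqP Bk _]]; rewrite -[X in (X <= _)%N]Bk rank_leq_col.
case: (ex_maxnP exQ ubQ) => k /asboolP[B [Bf AB]] kmax.
exists k, x0, B; split=> // x Ax; apply: contraT => xB.
suff /asboolP/kmax : Q (1 + k)%N by rewrite add1n ltnn.
exists (col_mx (x - x0) B); split.
  rewrite /row_free eqn_leq rank_leq_row /=.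
  have lt : (B < col_mx (x - x0) B)%MS.
    rewrite ltmxE col_mx_sub (negbTE xB) /= andbT.
    by have := submx_refl (col_mx (x - x0) B); rewrite col_mx_sub => /andP[].
  by rewrite [X in (X <= _)%N]add1n -[k in k.+1](eqP Bf); exact: rank_ltmx.
move=> i; case: (split_ordP i) => j ->.
  by rewrite rowKu row_id [x0 + _]addrC subrK.
by rewrite rowKd.
Qed.

Lemma has_dim0 n (A : set 'rV[R]_n) x : has_dim A 0 -> A x -> A = [set x].
Proof.
move=> [x0 [B [_ Ax0 _ AB]]].
have E y : A y -> y = x0.
  by move=> /AB /submxP[w]; rewrite thinmx0 mul0mx => /eqP; rewrite subr_eq0 => /eqP.
move=> Ax; apply/seteqP; split => [y Ay|y ->//] /=.
by rewrite (E _ Ay) (E _ Ax).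
Qed.

Lemma has_dim_set1 n (x : 'rV[R]_n) : has_dim [set x] 0.
Proof.
exists x, 0; split => [| //||y ->]; first by rewrite /row_free mxrank0.
- by case.
- by rewrite subrr sub0mx.
Qed.

(** A linear form that is constant on [F] is constant on the affine span of [F],
    which is that of [P] when the dimensions agree. *)
Lemma face_dim_eq n (P F : set 'rV[R]_n) k :
  face P F -> has_dim F k -> has_dim P k -> F = P.
Proof.
move=> fF [x0 [B [Bf Fx0 FB FsB]]] dP; have FP := face_sub fF.
case: fF FP => a [c [ac FE]] FP; apply/seteqP; split=> // x Px.
have aB i : dot a (row i B) = 0.
  have := FB i; have := Fx0; rewrite FE => -[_ xc] [_].
  by rewrite dotDr xc; lra.
have : (x - x0 <= B)%MS.
  apply: contraT => xB; have := has_dim_rank_le (V := B) (x1 := x0) dP.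
  case: dP => x1 [B1 [B1f Px1 PB1 PsB1]] _.
  have sB : (B <= B1)%MS.
    apply/row_subP => i.
    have -> : row i B = (x0 + row i B - x1) - (x0 - x1).
      by rewrite opprB addrA subrK addrAC subrr add0r.
    by rewrite addmx_sub ?eqmx_opp ?PsB1 //; apply: FP.
  have /eqmxP/eqmx_sym BB1 : (B == B1)%MS.
    by rewrite -(mxrank_leqif_eq sB) (eqP Bf) (eqP B1f).
  move: xB; rewrite -BB1.
  have -> : x - x0 = (x - x1) - (x0 - x1) by rewrite opprB addrA subrK.
  by rewrite addmx_sub ?eqmx_opp ?PsB1 //; apply: FP.
move=> /(dot_span aB); rewrite dotDr dotNr => h; rewrite FE; split=> //.
by move: Fx0; rewrite FE => -[_ <-]; lra.
Qed.

Lemma face_dim_lt n (P F : set 'rV[R]_n) j k : face P F -> F <> P ->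
  has_dim F j -> has_dim P k -> (j < k)%N.
Proof.
move=> fF nF dF dP; rewrite ltn_neqAle (has_dim_le dF dP) ?andbT; last first.
  exact: face_sub.
by apply/eqP => jk; apply: nF; apply: (face_dim_eq fF dF); rewrite jk.
Qed.

Lemma has_dim_ge1 n (A : set 'rV[R]_n) k x y :
  has_dim A k -> A x -> A y -> x <> y -> (0 < k)%N.
Proof.
by case: k => // d0 Ax Ay; move: Ay; rewrite (has_dim0 d0 Ax) /= => ->.
Qed.

Lemma has_dim_escape n (A : set 'rV[R]_n) k m (V : 'M[R]_(m, n)) x0 :
  has_dim A k -> (\rank V < k)%N -> exists2 x, A x & ~~ (x - x0 <= V)%MS.
Proof.
move=> dA rV; apply: contrapT => nex; move: rV; rewrite ltnNge.
move/negP; apply; apply: (has_dim_rank_le (x1 := x0) dA) => x Ax.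
by apply: contraT => xV; case: nex; exists x.
Qed.

(** A polytope has a vertex where a linear form is maximal: any two distinct
    generators are told apart by their difference, and the face where that form
    is maximal has fewer generators. *)
Lemma hull_vertex n (P : set 'rV[R]_n) : is_hull P -> P !=set0 ->
  exists v, vertices P v.
Proof.
move=> [s ->] [x /hull_inhabited {x}].
have [m] := ubnP (size s); elim: m s => // m IH s sm [x xs].
have [allx|] := boolP (all (pred1 x) s).
  exists x; exists 0, 0; split=> [y _|]; first by rewrite dot0l.
  have le1 a y : conv_hull s y -> dot a y <= dot a x.
    by apply: hull_le => z zs; rewrite (eqP (allP allx z zs)).
  apply/seteqP; split => [y ->|y [/= sy _]] /=.
    by rewrite dot0l; split=> //; exact: mem_hull.
  apply/eqP; rewrite -subr_eq0 -dot_eq0 eq_le dot_ge0 andbT.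
  by rewrite dotDr dotNr subr_le0; exact: le1.
case/allPn => y ys /= yx; pose a := x - y.
have [z zs zM] := seq_argmax (dot a) xs.
have fE := face_hull_filter zM.
have f1 : face (conv_hull s) (conv_hull [seq x <- s | dot a x == dot a z]).
  rewrite -fE; exists a, (dot a z); split=> //; exact: hull_le.
have yz : dot a y < dot a z.
  apply: lt_le_trans (zM _ xs); rewrite -subr_gt0.
  by rewrite -dotNr -dotDr dot_gt0 subr_eq0 eq_sym.
case: (IH [seq x <- s | dot a x == dot a z]) => [||v vF].
- rewrite -ltnS; apply: leq_trans sm; rewrite ltnS size_filter.
  rewrite -(count_predC (fun x => dot a x == dot a z) s) -addn1 leq_add2l.
  by rewrite -has_count; apply/hasP; exists y => //=; rewrite lt_eqF.
- by exists z; rewrite mem_filter eqxx.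
by exists v; apply: face_trans f1 vF; exists s.
Qed.

Lemma vertices_sub n (P : set 'rV[R]_n) : vertices P `<=` P.
Proof. by move=> v /face_sub; apply. Qed.

Lemma face_vertices n (P F : set 'rV[R]_n) :
  is_hull P -> face P F -> vertices F = vertices P `&` F.
Proof.
move=> hP fF; apply/seteqP; split=> [v vF|v [vP Fv]].
  by split; [exact: face_trans vF|exact: vertices_sub].
apply: (face_restrict vP); last exact: face_sub.
by move=> _ ->.
Qed.

Lemma hull_form_max n (P : set 'rV[R]_n) a : is_hull P -> P !=set0 ->
  exists2 v, vertices P v & forall x, P x -> dot a x <= dot a v.
Proof.
move=> hP [x Px]; have [s PE] := hP.
have [y ys] : exists y, y \in s by apply: (@hull_inhabited _ _ _ x); rewrite -PE.
have [z zs zM] := seq_argmax (dot a) ys.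
have PM : forall x, P x -> dot a x <= dot a z by rewrite PE; exact: hull_le.
pose F := [set x | P x /\ dot a x = dot a z].
have fF : face P F by exists a, (dot a z).
have [|v vF] := hull_vertex (face_hull hP fF).
  by exists z; split=> //; rewrite PE; exact: mem_hull.
exists v; first exact: face_trans vF.
by have [_ ->] := vertices_sub vF.
Qed.

Lemma hull_form_min n (P : set 'rV[R]_n) a : is_hull P -> P !=set0 ->
  exists2 v, vertices P v & forall x, P x -> dot a v <= dot a x.
Proof.
move=> hP /(hull_form_max (- a) hP)[v vP vM]; exists v => // x /vM.
by rewrite !dotNl lerN2.
Qed.

(** By this lemma the vertices determine the affine span: it is what is needed
    of the theorem that a polytope is the convex hull of its vertices. *)
Lemma form_const n (P : set 'rV[R]_n) a c : is_hull P ->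
  (forall v, vertices P v -> dot a v = c) -> forall x, P x -> dot a x = c.
Proof.
move=> hP ac x Px; have P0 : P !=set0 by exists x.
have [v /ac vc vM] := hull_form_max a hP P0.
have [w /ac wc wm] := hull_form_min a hP P0.
by apply/le_anti; rewrite -{1}vc vM //= -wc wm.
Qed.

Lemma finite_vertices n (P : set 'rV[R]_n) : is_hull P -> finite_set (vertices P).
Proof.
move=> [s ->]; apply: (@sub_finite_set _ _ [set` s]); last exact: finite_seq.
move=> v [a [c [ac vE]]]; have := face_hull_filter (fun x xs => ac x (mem_hull xs)).
rewrite -vE => E.
have [y ys] : exists y, y \in [seq x <- s | dot a x == c].
  by apply: (@hull_inhabited _ _ _ v); rewrite -E.
have : [set v] y by rewrite E; exact: mem_hull.
by move=> yv; move: ys; rewrite yv /= mem_filter => /andP[].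
Qed.

(** Tilting the supporting form [a] by [b] until it touches the hull at a point
    where [b] exceeds [e]. *)
Lemma tilt_supporting_form n (P : set 'rV[R]_n) a c b e y : is_hull P ->
  (forall x, P x -> dot a x <= c) -> P y -> e < dot b y ->
  exists l : R, (forall x, P x -> dot (a + l *: b) x <= c + l * e) /\
    exists z, [/\ P z, e < dot b z & dot (a + l *: b) z = c + l * e].
Proof.
move=> [s ->] ac Py ey.
have [x0 x0s] : exists x, x \in [seq x <- s | e < dot b x].
  apply: contrapT => nex; move: ey; rewrite ltNge => /negP; apply.
  apply: hull_le Py => x xs; rewrite leNgt; apply/negP => xb; apply: nex.
  by exists x; rewrite mem_filter xb.
(* [rat x] is the multiple of [b] at which the tilted form reaches [x]. *)
pose rat x := (c - dot a x) / (dot b x - e).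
have [z zs zm] := seq_argmax (fun x => - rat x) x0s.
move: zs; rewrite mem_filter => /andP[ez zs].
have zP := mem_hull zs.
exists (rat z); split; last first.
  exists z; split=> //; rewrite dotDl dotZl /rat.
  have : dot b z - e != 0 by rewrite subr_eq0 gt_eqF.
  by move=> h; field.
have r0 : 0 <= rat z.
  by rewrite divr_ge0 // ?subr_ge0 ?ac // ltW.
apply: hull_le => x xs; rewrite dotDl dotZl.
have ax := ac x (mem_hull xs).
have [ex|xe] := ltP e (dot b x); last first.
  by rewrite lerD // ler_wpM2l.
have := zm x; rewrite mem_filter ex xs lerN2 => /(_ isT).
rewrite {2}/rat ler_pdivlMr ?subr_gt0 //; lra.
Qed.

End Dimension.

(** * Edges and chains of faces *)

Section Edges.
Variable R : realType.
Implicit Types n k : nat.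

Lemma kface_trans n j k (P F G : set 'rV[R]_n) :
  is_hull P -> kface k P F -> kface j F G -> kface j P G.
Proof. by move=> hP [fF _] [fG dG]; split=> //; exact: face_trans fG. Qed.

Lemma face_strict n (P F : set 'rV[R]_n) : face P F ->
  exists a c, [/\ forall x, P x -> dot a x <= c, forall x, F x -> dot a x = c
    & forall x, P x -> ~ F x -> dot a x < c].
Proof.
move=> [a [c [ac FE]]]; exists a, c; split=> // [x|x Px nFx]; first by rewrite FE => -[].
by rewrite lt_neqAle ac // andbT; apply/eqP => xc; apply: nFx; rewrite FE.
Qed.

(** If [F] together with one more point does not affinely span [P], then the
    supporting form of [F] can be tilted about their span until a further point
    of [P] is reached; the face so obtained is still proper. *)
Lemma kface_up n k j (P F : set 'rV[R]_n) : is_hull P -> has_dim P k ->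
  kface j P F -> (j < k)%N -> exists2 F', kface j.+1 P F' & F `<=` F'.
Proof.
have [m] := ubnP k; elim: m k P => // m IH k P km hP dP [fF dF] jk.
have FP := face_sub fF.
have [jkE|jk1] : j.+1 = k \/ (j.+1 < k)%N by lia.
  by exists P => //; split; [exact: face_refl|rewrite jkE].
have [x0 [B [Bf Fx0 FB FsB]]] := dF.
have [a [c [ac Fc aF]]] := face_strict fF.
have rB : (\rank B < k)%N by rewrite (eqP Bf).
have [y0 Py0 y0B] := has_dim_escape x0 dP rB.
have nFy0 : ~ F y0 by move=> /FsB; apply/negP.
have rV : (\rank (col_mx (y0 - x0) B) < k)%N.
  exact: leq_ltn_trans (rank_leq_row _) jk1.
have [y Py yV] := has_dim_escape x0 dP rV.
have [b [b0 by0]] := separating_form yV.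
have bF x : F x -> dot b x = dot b x0.
  move=> /FsB xB; have : dot b (x - x0) = 0.
    apply: b0; apply: submx_trans xB _.
    by have := submx_refl (col_mx (y0 - x0) B); rewrite col_mx_sub => /andP[].
  by rewrite !dotE; lra.
have by0E : dot b y0 = dot b x0.
  have : dot b (y0 - x0) = 0.
    apply: b0.
    by have := submx_refl (col_mx (y0 - x0) B); rewrite col_mx_sub => /andP[].
  by rewrite !dotE; lra.
have [|l [lP [z [Pz bz lz]]]] := @tilt_supporting_form _ _ P a c b (dot b x0) y hP ac Py.
  by move: by0; rewrite !dotE; lra.
pose G := [set x | P x /\ dot (a + l *: b) x = c + l * dot b x0].
have fG : face P G by exists (a + l *: b), (c + l * dot b x0).
have FG : F `<=` G.
  by move=> x Fx; split; [exact: FP|rewrite !dotE (Fc _ Fx) (bF _ Fx)].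
have Gz : G z by [].
(* [y0] keeps the new face proper. *)
have nGy0 : ~ G y0.
  by move=> [_]; rewrite !dotE by0E; have := aF _ Py0 nFy0; lra.
have nFz : ~ F z by move=> /bF; lra.
have [kG dG] : exists k', has_dim G k' by apply: has_dim_exists; exists z.
have kGk : (kG < k)%N.
  by apply: face_dim_lt fG _ dG dP => GP; apply: nGy0; rewrite GP.
have fFG : face G F by apply: face_restrict fF FG _; exact: face_sub.
have jkG : (j < kG)%N.
  by apply: face_dim_lt fFG _ dF dG => FGE; apply: nFz; rewrite FGE.
have hG := face_hull hP fG.
have [F' F'G FF'] := IH kG G (leq_trans kGk km) hG dG (conj fFG dF) jkG.
by exists F' => //; exact: kface_trans hP (conj fG dG) F'G.
Qed.

Lemma kface_up_to n k j i (P F : set 'rV[R]_n) : is_hull P -> has_dim P k ->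
  kface j P F -> (j <= i <= k)%N -> exists2 F', kface i P F' & F `<=` F'.
Proof.
move=> hP dP fF; elim: i => [|i IH].
  by rewrite leqn0 => /andP[/eqP j0 _]; exists F => //; rewrite -j0.
rewrite leq_eqVlt => /andP[/predU1P[<- _|ji ik]]; first by exists F.
have [|G fG FG] := IH; first by rewrite -ltnS ji ltnW.
have [F' fF' GF'] := kface_up hP dP fG ik.
by exists F' => // x /FG/GF'.
Qed.

(** The endpoints are the vertices at which the form given by the direction of
    the segment is extremal; an interior point is not exposed, as a linear
    form that is maximal there is constant on the segment. *)
Lemma edge_segment n (e : set 'rV[R]_n) : is_hull e -> has_dim e 1 ->
  exists u v, [/\ u != v, vertices e = [set u; v] &
    forall x, e x -> exists t : R, 0 <= t <= 1 /\ x = u + t *: (v - u)].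
Proof.
move=> he de; have e0 := has_dim_inhabited de.
have [x0 [B [Bf ex0 eB esB]]] := de.
have bN0 : 0 < dot (row 0 B) (row 0 B).
  by rewrite dot_gt0 row_id -mxrank_eq0 (eqP Bf).
set b := row 0 B in bN0.
have line x : e x -> exists w, x = x0 + w *: b.
  move=> /esB /submxP[w wE]; exists (w 0 0).
  by rewrite -[LHS](subrK x0) wE mulmx_sum_row big_ord1 addrC.
have [v ve vM] := hull_form_max b he e0.
have [u ue um] := hull_form_min b he e0.
have [wu uE] := line _ (vertices_sub ue); have [wv vE] := line _ (vertices_sub ve).
have wuv : wu < wv.
  have := vM _ (eB 0); have := um _ ex0.
  rewrite -/b uE vE !dotE => h1 h2.
  by rewrite -(ltr_pM2r bN0); lra.
have uv : u != v.
  rewrite uE vE; apply/eqP => /addrI /(congr1 (dot b)); rewrite !dotE => h.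
  by move: wuv; rewrite -(ltr_pM2r bN0) h ltxx.
have seg x : e x -> exists t : R, 0 <= t <= 1 /\ x = u + t *: (v - u).
  move=> ex; have [w xE] := line _ ex; exists ((w - wu) / (wv - wu)).
  have d0 : 0 < wv - wu by rewrite subr_gt0.
  have wuw : wu <= w.
    by have := um _ ex; rewrite uE xE !dotE lerD2l ler_pM2r.
  have wwv : w <= wv.
    by have := vM _ ex; rewrite vE xE !dotE lerD2l ler_pM2r.
  split; first by rewrite ler_pdivlMr // mul0r ler_pdivrMr // mul1r; lra.
  rewrite uE vE xE opprD addrACA subrr add0r -scalerBl scalerA divfK ?gt_eqF //.
  by rewrite -addrA -scalerDl; congr (_ + _ *: _); ring.
exists u, v; split=> //; apply/seteqP; split=> [w we|w [->|->]] //=.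
have [a [c [ac wc aw]]] := face_strict we.
have {wc} wc := wc w erefl.
have [t [/andP[t0 t1] wE]] := seg _ (vertices_sub we).
apply: contrapT => nw.
have uc : dot a u < c.
  by apply: aw; [exact: vertices_sub|move=> uw; apply: nw; left].
have vc : dot a v < c.
  by apply: aw; [exact: vertices_sub|move=> vw; apply: nw; right].
have [t00|tn0] := eqVneq t 0; first by move: wc; rewrite wE !dotE t00; lra.
have h1 : 0 < t * (c - dot a v) by rewrite mulr_gt0 ?subr_gt0 // lt0r tn0.
have h2 : 0 <= (1 - t) * (c - dot a u) by rewrite mulr_ge0 ?subr_ge0 // ltW.
by move: wc; rewrite wE !dotE; lra.
Qed.

Lemma edge_at n k (P : set 'rV[R]_n) x : is_hull P -> has_dim P k -> (0 < k)%N ->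
  vertices P x -> exists e y, [/\ kface 1 P e, x != y & vertices e = [set x; y]].
Proof.
move=> hP dP k0 xP.
have [e eP xe] := kface_up hP dP (conj xP (has_dim_set1 x)) k0.
have he := face_hull hP eP.1.
have [u [v [uv eE _]]] := edge_segment he eP.2.
have : vertices e x by rewrite (face_vertices hP eP.1); split=> //; exact: xe.
rewrite eE => -[->|->]; [exists e, v|exists e, u]; split=> //.
  by rewrite eq_sym.
by rewrite setUC.
Qed.

Lemma polygon_edge n (F G : set 'rV[R]_n) x y : has_dim F 2 -> face F G ->
  G <> F -> G x -> G y -> x <> y -> kface 1 F G.
Proof.
move=> dF fG GF Gx Gy xy.
have [k dG] : exists k, has_dim G k by apply: has_dim_exists; exists x.
have := face_dim_lt fG GF dG dF; have := has_dim_ge1 dG Gx Gy xy.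
move=> k1 k2; have k1E : k = 1%N by lia.
by rewrite k1E in dG.
Qed.

(** The second edge at [x] is found by tilting the form that exposes [x] away
    from the first one. *)
Lemma polygon_two_edges n (F : set 'rV[R]_n) x : is_hull F -> has_dim F 2 ->
  vertices F x -> exists e1 e2 y1 y2,
    [/\ [/\ kface 1 F e1, x != y1 & vertices e1 = [set x; y1]],
        [/\ kface 1 F e2, x != y2 & vertices e2 = [set x; y2]] & y1 != y2].
Proof.
move=> hF dF xF; have [e1 [y1 [e1F xy1 e1E]]] := edge_at hF dF isT xF.
have [a [c [ac xc ax]]] := face_strict xF.
have {}xc := xc x erefl.
have [a1 [c1 [ac1 e1c ae1]]] := face_strict e1F.1.
have e1y1 : e1 y1 by apply: vertices_sub; rewrite e1E; right.
have e1x : e1 x by apply: vertices_sub; rewrite e1E; left.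
have Fx := vertices_sub xF.
have Fy1 : F y1 := face_sub e1F.1 e1y1.
have [w Fw ne1w] : exists2 w, F w & ~ e1 w.
  apply: contrapT => nex; suff E : e1 = F.
    by have := has_dim_uniq e1F.2; rewrite E => /(_ _ dF).
  apply/seteqP; split=> [|w Fw]; first exact: face_sub e1F.1.
  by apply: contrapT => ne; apply: nex; exists w.
have [|l [lP [z [Pz bz lz]]]] := @tilt_supporting_form _ _ F a c (- a1) (- c1) w hF ac Fw.
  by rewrite dotNl ltrN2; exact: ae1.
pose G := [set x | F x /\ dot (a + l *: - a1) x = c + l * - c1].
have fG : face F G by exists (a + l *: - a1), (c + l * - c1).
have Gx : G x by split=> //; rewrite !dotE xc (e1c _ e1x).
have Gz : G z by [].
have nGy1 : ~ G y1.
  have ay : dot a y1 < c.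
    by apply: ax => // yx; move: xy1; rewrite yx eqxx.
  by move=> [_]; rewrite !dotE (e1c _ e1y1); lra.
have xz : x <> z.
  by move=> xz; move: bz; rewrite -xz dotNl (e1c _ e1x) ltxx.
have GF : G <> F by move=> GF; apply: nGy1; rewrite GF.
have fG1 := polygon_edge dF fG GF Gx Gz xz.
have hG := face_hull hF fG.
have [u [v [uv GE _]]] := edge_segment hG fG1.2.
have xG : vertices G x by rewrite (face_vertices hF fG).
have [y2 [xy2 Gy2]] : exists y2, x != y2 /\ vertices G = [set x; y2].
  move: xG; rewrite GE => -[->|->]; [exists v|exists u]; split=> //.
    by rewrite eq_sym.
  by rewrite setUC.
exists e1, G, y1, y2; split=> //; apply/eqP => y12; apply: nGy1.
by apply: vertices_sub; rewrite Gy2 y12; right.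
Qed.

End Edges.

(** * Similarities *)

Section Similarities.
Variable R : realType.
Implicit Types n m k : nat.

(** A similarity with its ratio. It is only required on [P], so that with ratio 1
    and [Q = P] it is a symmetry of [P] within its affine hull, a notion that can
    be transported between ambient spaces. *)
Definition scaling (r : R) n m (P : set 'rV[R]_n) (Q : set 'rV[R]_m)
    (phi : 'rV[R]_n -> 'rV[R]_m) :=
  [/\ 0 < r, forall x y, P x -> P y -> edist (phi x) (phi y) = r * edist x y
    & phi @` P = Q].

Lemma similar_scaling n m (P : set 'rV[R]_n) (Q : set 'rV[R]_m)
    (phi : 'rV[R]_n -> 'rV[R]_m) :
  Defs.similar P Q phi <-> exists r, scaling r P Q phi.
Proof. by split=> [[[r r0 rE] PQ]|[r [r0 rE PQ]]]; [exists r|split=> //; exists r]. Qed.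

Lemma scaling_inj r n m (P : set 'rV[R]_n) (Q : set 'rV[R]_m)
    (phi : 'rV[R]_n -> 'rV[R]_m) x y :
  scaling r P Q phi -> P x -> P y -> phi x = phi y -> x = y.
Proof.
move=> [r0 rE _] Px Py xy; apply/eqP; rewrite -edist_eq0.
by move: (rE _ _ Px Py); rewrite xy edistxx => /esym/eqP; rewrite mulf_eq0 gt_eqF.
Qed.

Lemma scaling_mem r n m (P : set 'rV[R]_n) (Q : set 'rV[R]_m)
    (phi : 'rV[R]_n -> 'rV[R]_m) x :
  scaling r P Q phi -> P x -> Q (phi x).
Proof. by move=> [_ _ <-] Px; exists x. Qed.

Lemma scaling_sub r n m (P F : set 'rV[R]_n) (Q : set 'rV[R]_m)
    (phi : 'rV[R]_n -> 'rV[R]_m) :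
  scaling r P Q phi -> F `<=` P -> scaling r F (phi @` F) phi.
Proof. by move=> [r0 rE _] FP; split=> // x y /FP Px /FP Py; exact: rE. Qed.

Lemma scaling_comp r s n m p (P : set 'rV[R]_n) (Q : set 'rV[R]_m)
    (T : set 'rV[R]_p)
    (phi : 'rV[R]_n -> 'rV[R]_m) (psi : 'rV[R]_m -> 'rV[R]_p) :
  scaling r P Q phi -> scaling s Q T psi -> scaling (s * r) P T (psi \o phi).
Proof.
move=> sP [s0 sE <-]; have [r0 rE PQ] := sP; split.
- exact: mulr_gt0.
- move=> x y Px Py; rewrite /= sE ?rE ?mulrA //; exact: scaling_mem sP _.
- by rewrite -PQ -image_comp.
Qed.

Lemma scaling_inv r n m (P : set 'rV[R]_n) (Q : set 'rV[R]_m)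
    (phi : 'rV[R]_n -> 'rV[R]_m) :
  scaling r P Q phi -> exists psi, [/\ scaling r^-1 Q P psi,
    forall x, P x -> psi (phi x) = x & forall y, Q y -> phi (psi y) = y].
Proof.
move=> sP; have [r0 rE PQ] := sP.
pose psi y := xget 0 [set x | P x /\ phi x = y].
have psiP y : Q y -> P (psi y) /\ phi (psi y) = y.
  rewrite -PQ => -[x Px xy]; rewrite /psi; case: xgetP => [z -> //|/(_ x)].
  by case.
have psiK x : P x -> psi (phi x) = x.
  move=> Px; have [h1 h2] := psiP _ (scaling_mem sP Px).
  exact: scaling_inj sP h1 Px h2.
exists psi; split=> // [|y Qy]; last by case: (psiP y Qy).
split; first by rewrite invr_gt0.
- move=> x y Qx Qy; have [Px xE] := psiP _ Qx; have [Py yE] := psiP _ Qy.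
  by rewrite -[in RHS]xE -[in RHS]yE rE // mulKf ?gt_eqF.
- apply/seteqP; split => [x [y Qy <-]|x Px]; first by case: (psiP y Qy).
  by exists (phi x); [exact: scaling_mem sP Px|exact: psiK].
Qed.

Lemma scaling_dot r n m (P : set 'rV[R]_n) (Q : set 'rV[R]_m)
    (phi : 'rV[R]_n -> 'rV[R]_m) x0 x y :
  scaling r P Q phi -> P x0 -> P x -> P y ->
  dot (phi x - phi x0) (phi y - phi x0) = r ^+ 2 * dot (x - x0) (y - x0).
Proof.
move=> [r0 rE _] P0 Px Py.
have sq u v : P u -> P v ->
    dot (phi u - phi v) (phi u - phi v) = r ^+ 2 * dot (u - v) (u - v).
  by move=> Pu Pv; rewrite -!edist_sqr rE // exprMn.
have := sq _ _ Px Py; have := sq _ _ Px P0; have := sq _ _ Py P0.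
rewrite !dotE ?(dotC (phi y) (phi x)) ?(dotC (phi y) (phi x0)) ?(dotC (phi x) (phi x0)).
rewrite ?(dotC y x) ?(dotC y x0) ?(dotC x x0); lra.
Qed.

(** A similarity on [P] agrees with an affine map, because the norm of the defect
    of affinity is a combination of inner products, which are preserved up to the
    factor [r ^+ 2]. Hence it carries an affine frame of [P] to one of [Q], and
    every linear form on [P] is the pullback of one on [Q]. *)
Lemma scaling_dim_form r n m (P : set 'rV[R]_n) (Q : set 'rV[R]_m)
    (phi : 'rV[R]_n -> 'rV[R]_m) k :
  scaling r P Q phi -> has_dim P k ->
  has_dim Q k /\ forall a, exists a', forall x y, P x -> P y ->
    dot a' (phi x - phi y) = dot a (x - y).
Proof.
move=> sP [x0 [B [Bf Px0 PB PsB]]]; have [r0 rE PQ] := sP.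
pose B' : 'M_(k, m) := \matrix_i (phi (x0 + row i B) - phi x0).
have dotBB' (w : 'rV_k) : dot (w *m B') (w *m B') = r ^+ 2 * dot (w *m B) (w *m B).
  rewrite !mulmx_sum_row !dot_sumr mulr_sumr; apply: eq_bigr => i _.
  rewrite dotC dot_sumr [in RHS]dotC dot_sumr mulr_sumr; apply: eq_bigr => j _.
  rewrite !dotZl !dotZr !rowK (scaling_dot sP) //.
  by rewrite ![_ + _ - x0]addrAC !subrr !add0r; ring.
have B'f : row_free B'.
  apply/row_freeP; apply/row_freeP; rewrite -kermx_eq0.
  apply/eqP/row_matrixP => i; rewrite row0; set w := row i _.
  have : w *m B' = 0 by rewrite /w -row_mul mulmx_ker row0.
  move=> wB'; have := dotBB' w; rewrite wB' dot0l => /esym/eqP.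
  rewrite mulf_eq0 sqrf_eq0 gt_eqF //= dot_eq0 => /eqP wB.
  by apply: (row_free_inj Bf); rewrite mul0mx.
have lin x : P x -> forall w : 'rV_k, x - x0 = w *m B -> phi x - phi x0 = w *m B'.
  move=> Px w xw; apply/eqP; rewrite -subr_eq0 -dot_eq0; apply/eqP.
  have Px0i i : dot (phi x - phi x0) (row i B') = r ^+ 2 * dot (x - x0) (row i B).
    by rewrite rowK (scaling_dot sP) // [_ + _ - x0]addrAC subrr add0r.
  have c1 : dot (phi x - phi x0) (w *m B') = r ^+ 2 * dot (x - x0) (w *m B).
    rewrite !mulmx_sum_row !dot_sumr mulr_sumr; apply: eq_bigr => i _.
    by rewrite !dotZr Px0i; ring.
  have := scaling_dot sP Px0 Px Px; have := dotBB' w.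
  move: c1; rewrite xw; move: (phi x - phi x0) (w *m B') (w *m B) => u v b.
  by rewrite !dotE (dotC v u) => -> -> ->; ring.
split.
  exists (phi x0), B'; split=> //.
  - exact: scaling_mem sP _.
  - by move=> i; rewrite rowK addrC subrK; apply: scaling_mem sP _.
  - move=> y; rewrite -PQ => -[x Px <-]; have /submxP[w xw] := PsB x Px.
    by rewrite (lin x Px w xw) submxMl.
move=> a; have /row_freeP[C B'C] := B'f.
exists (a *m B^T *m C^T) => x y Px Py.
have H z : P z -> dot (a *m B^T *m C^T) (phi z - phi x0) = dot a (z - x0).
  move=> Pz; have /submxP[w zw] := PsB z Pz.
  rewrite (lin z Pz w zw) zw !dot_mx !trmx_mul !mulmxA; congr fun_of_matrix.
  rewrite -[_ *m C^T *m _]mulmxA -trmx_mul B'C trmx1 mulmx1.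
  by [].
by have := H x Px; have := H y Py; rewrite !dotDr !dotNr; lra.
Qed.

Lemma scaling_dim r n m (P : set 'rV[R]_n) (Q : set 'rV[R]_m)
    (phi : 'rV[R]_n -> 'rV[R]_m) k :
  scaling r P Q phi -> has_dim P k -> has_dim Q k.
Proof. by move=> sP dP; have [] := scaling_dim_form sP dP. Qed.

Lemma scaling_face r n m (P F : set 'rV[R]_n) (Q : set 'rV[R]_m)
    (phi : 'rV[R]_n -> 'rV[R]_m) :
  scaling r P Q phi -> P !=set0 -> face P F -> face Q (phi @` F).
Proof.
move=> sP P0 [a [c [ac ->]]]; have [k dP] := has_dim_exists P0.
have [_ /(_ a)[a' aE]] := scaling_dim_form sP dP.
have [x0 Px0] := P0; have [_ _ PQ] := sP.
have E x : P x -> dot a' (phi x) = dot a x + (dot a' (phi x0) - dot a x0).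
  by move=> Px; have := aE _ _ Px Px0; rewrite !dotE; lra.
exists a', (c + (dot a' (phi x0) - dot a x0)); split.
  by move=> y; rewrite -PQ => -[x Px <-]; rewrite E // lerD2r ac.
apply/seteqP; split=> [y [x [Px xc] <-]|y [Qy yc]] /=.
  by rewrite E // xc; split=> //; exact: scaling_mem sP Px.
move: Qy; rewrite -PQ => -[x Px xy]; exists x => //; split=> //.
by move: yc; rewrite -xy E // => /addIr.
Qed.

Lemma scaling_kface r n m (P F : set 'rV[R]_n) (Q : set 'rV[R]_m)
    (phi : 'rV[R]_n -> 'rV[R]_m) k :
  scaling r P Q phi -> kface k P F -> kface k Q (phi @` F).
Proof.
move=> sP [fF dF]; have FP := face_sub fF.
have [x /FP Px] := has_dim_inhabited dF.
split; first by apply: scaling_face sP _ fF; exists x.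
exact: scaling_dim (scaling_sub sP FP) dF.
Qed.

Lemma scaling_kface_inv r n m (P : set 'rV[R]_n) (Q G : set 'rV[R]_m)
    (phi : 'rV[R]_n -> 'rV[R]_m) k :
  scaling r P Q phi -> kface k Q G -> exists2 F, kface k P F & phi @` F = G.
Proof.
move=> sP fG; have [psi [sQ _ phiK]] := scaling_inv sP.
exists (psi @` G); first exact: scaling_kface sQ fG.
rewrite image_comp; apply/seteqP; split=> [y [x Gx <-] /=|x Gx].
  by rewrite phiK //; exact: face_sub fG.1 _ Gx.
by exists x => //=; rewrite phiK //; exact: face_sub fG.1 _ Gx.
Qed.

Lemma scaling_vertices r n m (P : set 'rV[R]_n) (Q : set 'rV[R]_m)
    (phi : 'rV[R]_n -> 'rV[R]_m) :
  scaling r P Q phi -> vertices Q = phi @` vertices P.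
Proof.
move=> sP.
apply/seteqP; split=> [y yQ|_ [x xP <-]].
  have [F [fF dF] FE] := scaling_kface_inv sP (conj yQ (has_dim_set1 y)).
  have [x Fx] := has_dim_inhabited dF; rewrite (has_dim0 dF Fx) in fF.
  exists x => //; have : (phi @` F) (phi x) by exists x.
  by rewrite FE.
have := scaling_kface sP (conj xP (has_dim_set1 x)).
by rewrite image_set1 => -[].
Qed.

(** Similar hulls have corresponding face lattices, so a similarity meets the
    combinatorial condition required of a canonical realisation. *)
Lemma scaling_comb_equiv r n m (P : set 'rV[R]_n) (Q : set 'rV[R]_m)
    (phi : 'rV[R]_n -> 'rV[R]_m) :
  is_hull P -> P !=set0 -> scaling r P Q phi -> comb_equiv P Q phi.
Proof.
move=> hP P0 sP; have vQ := scaling_vertices sP; split.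
  split=> [x xP|x y /set_mem xP /set_mem yP|y]; first by rewrite vQ; exists x.
    by apply: scaling_inj sP _ _; exact: vertices_sub.
  by rewrite vQ.
have [psi [sQ psiK phiK]] := scaling_inv sP.
have vim F : face P F -> vertices (phi @` F) = phi @` vertices F.
  by move=> /face_sub FP; exact: scaling_vertices (scaling_sub sP FP).
move=> W WP; split=> [[F fF FW]|[G fG GW]].
  exists (phi @` F); last by rewrite vim // FW.
  exact: scaling_face sP _ fF.
have Q0 : Q !=set0 by case: P0 => x /(scaling_mem sP); exists (phi x).
have fF := scaling_face sQ Q0 fG.
have FG : phi @` (psi @` G) = G.
  rewrite image_comp; apply/seteqP; split=> [y [x Gx <-] /=|x Gx].
    by rewrite phiK //; exact: face_sub fG _ Gx.
  by exists x => //=; rewrite phiK //; exact: face_sub fG _ Gx.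
exists (psi @` G) => //; have := vim _ fF; rewrite FG GW.
have sub : vertices (psi @` G) `<=` P.
  by rewrite (face_vertices hP fF) => x [/vertices_sub].
move=> E; apply/seteqP; split=> [x xF|x Wx].
  have : (phi @` W) (phi x) by rewrite E; exists x.
  case=> y Wy /(scaling_inj sP) <- //; last exact: sub.
  by apply: vertices_sub; exact: WP.
have : (phi @` vertices (psi @` G)) (phi x) by rewrite -E; exists x.
case=> y Wy /(scaling_inj sP) <- //; first exact: sub.
by apply: vertices_sub; exact: WP.
Qed.

End Similarities.

(** * Uniformity *)

Section Uniformity.
Variable R : realType.
Implicit Types n m k : nat.

Definition isogonal n (P : set 'rV[R]_n) := forall u v,
  vertices P u -> vertices P v -> exists2 g, scaling 1 P P g & g u = v.

Definition equilateral n (P : set 'rV[R]_n) := forall e e' x y x' y',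
  edge P e -> edge P e' -> x != y -> x' != y' ->
  vertices e = [set x; y] -> vertices e' = [set x'; y'] ->
  edist x y = edist x' y'.

(** What the proof retains of uniformity. Unlike uniformity itself it is plainly
    inherited by faces and by similar copies in other spaces. *)
Definition homogeneous n (P : set 'rV[R]_n) := forall k F,
  (2 <= k)%N -> kface k P F -> isogonal F /\ (k = 2%N -> equilateral F).

Lemma symmetry_scaling n (P : set 'rV[R]_n) g : symmetry P g -> scaling 1 P P g.
Proof. by move=> [gE gP]; split=> // x y _ _; rewrite gE mul1r. Qed.

Lemma pair_vertex_inj n m (e : set 'rV[R]_n) (e' : set 'rV[R]_m) r g x y x' y' :
  scaling r e e' g -> x != y -> vertices e = [set x; y] ->
  vertices e' = [set x'; y'] -> g x = x' -> g y = y'.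
Proof.
move=> se xy eE e'E gx.
have ex : e x by apply: vertices_sub; rewrite eE; left.
have ey : e y by apply: vertices_sub; rewrite eE; right.
have : vertices e' (g y).
  by rewrite (scaling_vertices se); exists y => //; rewrite eE; right.
rewrite e'E => -[/= gy|//]; have : g x = g y by rewrite gx gy.
by move/(scaling_inj se ex ey) => xyE; rewrite xyE eqxx in xy.
Qed.

Lemma polygon_flag n (P e : set 'rV[R]_n) x : has_dim P 2 -> vertices P x ->
  edge P e -> e x ->
  flag 2 P (fun i => if i is i'.+1 then if i' is 0 then e else P else [set x]).
Proof.
move=> dP xP eP ex; split=> //.
- case=> [_|[_|[|//] _]] //; last by split=> //; exact: face_refl.
  by split=> //; exact: has_dim_set1.
- case=> [_ y -> //|[_|//]]; exact: face_sub eP.1.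
Qed.

Lemma regular_polygon_homogeneous n (P : set 'rV[R]_n) :
  is_hull P -> has_dim P 2 -> Defs.regular 2 P -> isogonal P /\ equilateral P.
Proof.
move=> hP dP regP; split=> [u v uP vP|e e' x y x' y' eP e'P xy xy' eE e'E].
  have [e [y [eP _ eE]]] := edge_at hP dP isT uP.
  have [e' [y' [e'P _ e'E]]] := edge_at hP dP isT vP.
  have eu : e u by apply: vertices_sub; rewrite eE; left.
  have e'v : e' v by apply: vertices_sub; rewrite e'E; left.
  have [g gs /(_ 0%N isT) /=] :=
    regP _ _ (polygon_flag dP uP eP eu) (polygon_flag dP vP e'P e'v).
  rewrite image_set1 => guv; exists g; first exact: symmetry_scaling.
  by have : [set g u] (g u) by []; rewrite guv.
have ex : vertices e x by rewrite eE; left.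
have e'x' : vertices e' x' by rewrite e'E; left.
have ey : vertices e y by rewrite eE; right.
have xP : vertices P x by move: ex; rewrite (face_vertices hP eP.1) => -[].
have x'P : vertices P x' by move: e'x'; rewrite (face_vertices hP e'P.1) => -[].
have [g gs fg] := regP _ _ (polygon_flag dP xP eP (vertices_sub ex))
  (polygon_flag dP x'P e'P (vertices_sub e'x')).
have gx : g x = x'.
  by have := fg 0%N isT; rewrite /= image_set1 => E; have : [set g x] (g x) by []; rewrite E.
have ge : g @` e = e' := fg 1%N isT.
have se : scaling 1 e e' g.
  by rewrite -ge; apply: scaling_sub (symmetry_scaling gs) _; exact: face_sub eP.1.
rewrite -gx -(pair_vertex_inj se xy eE e'E gx).
by case: gs.
Qed.

(** Uniformity constrains facets only; a face of smaller dimension is reached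
    through a facet that contains it. *)
Lemma uniform_homogeneous n k (P : set 'rV[R]_n) : (2 <= k)%N ->
  is_hull P -> has_dim P k -> uniform k P -> homogeneous P.
Proof.
elim: k P => [|k IH] P //; rewrite leq_eqVlt => /predU1P[[<-]|k2] hP dP /=.
  move=> regP k' F k'2 fF.
  have k'E : k' = 2%N.
    by have := has_dim_le fF.2 dP (face_sub fF.1); lia.
  have <- : P = F.
    by apply/esym; apply: face_dim_eq fF.1 _ dP; rewrite -k'E; exact: fF.2.
  by have [] := regular_polygon_homogeneous hP dP regP.
have k1 : (1 < k)%N by [].
rewrite k1.
move=> [uF vtP] j F j2 fF.
have jk := has_dim_le fF.2 dP (face_sub fF.1).
have [jkE|jk1] : j = k.+1 \/ (j <= k)%N by lia.
  have -> : F = P by apply: face_dim_eq fF.1 _ dP; rewrite -jkE; exact: fF.2.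
  split; last by lia.
  by move=> u v uP vP; have [g gs gu] := vtP _ _ uP vP; exists g => //; exact: symmetry_scaling.
have [|F' fF' FF'] := kface_up_to (i := k) hP dP fF; first by lia.
apply: (IH F' _ (face_hull hP fF'.1) fF'.2 (uF _ fF') j) => //.
by split; [exact: face_restrict fF.1 FF' (face_sub fF'.1)|exact: fF.2].
Qed.

Lemma homogeneous_face n k (P F : set 'rV[R]_n) :
  is_hull P -> kface k P F -> homogeneous P -> homogeneous F.
Proof.
by move=> hP fF HP j G j2 fG; apply: HP j2 _; exact: kface_trans hP fF fG.
Qed.

Lemma homogeneous_scaling r n m (P : set 'rV[R]_n) (Q : set 'rV[R]_m)
    (phi : 'rV[R]_n -> 'rV[R]_m) :
  scaling r P Q phi -> homogeneous P -> homogeneous Q.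
Proof.
move=> sP HP k G k2 fG; have [F fF FG] := scaling_kface_inv sP fG.
have FP := face_sub fF.1.
have sF : scaling r F G phi by rewrite -FG; exact: scaling_sub sP FP.
have [psi [sG psiK phiK]] := scaling_inv sF.
have [isoF eqF] := HP _ _ k2 fF; split=> [u v|k2E e e' x y x' y' eG e'G xy xy' eE e'E].
  rewrite (scaling_vertices sF) => -[u' u'F <-] [v' v'F <-].
  have [g sg gu] := isoF _ _ u'F v'F.
  exists (phi \o (g \o psi)); last by rewrite /= psiK ?gu //; exact: vertices_sub.
  have := scaling_comp (scaling_comp sG sg) sF.
  by rewrite mul1r mulfV // gt_eqF //; case: sF.
have r0 : 0 < r by case: sF.
have lift a b d : edge G d -> a != b -> vertices d = [set a; b] -> exists d' a' b',
    [/\ edge F d', a' != b', vertices d' = [set a'; b'] & edist a b = r * edist a' b'].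
  move=> dG ab dE; have sd := scaling_sub sG (face_sub dG.1).
  have da : G a by apply: face_sub dG.1 _ _; apply: vertices_sub; rewrite dE; left.
  have db : G b by apply: face_sub dG.1 _ _; apply: vertices_sub; rewrite dE; right.
  exists (psi @` d), (psi a), (psi b); split.
  - exact: scaling_kface sG dG.
  - by apply: contra ab => /eqP /(scaling_inj sG da db) ->.
  - by rewrite (scaling_vertices sd) dE image_setU !image_set1.
  - by case: sG => _ -> // _; rewrite mulrA mulfV ?mul1r // gt_eqF.
have [d [a [b [dF ab dE ->]]]] := lift _ _ _ eG xy eE.
have [d' [a' [b' [d'F ab' d'E ->]]]] := lift _ _ _ e'G xy' e'E.
by rewrite (eqF k2E d d' a b a' b').
Qed.

End Uniformity.

(** * Barycentres *)

Section Barycentres.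
Variable R : realType.
Implicit Types n m k : nat.

Lemma sum_fset_image (n m : nat) (T : nmodType) (A : set 'rV[R]_n)
    (g : 'rV[R]_n -> 'rV[R]_m) (h : 'rV[R]_m -> T) :
  finite_set A -> {in A &, injective g} ->
  \sum_(y <- fset_set (g @` A)) h y = \sum_(x <- fset_set A) h (g x).
Proof.
move=> fA gi; rewrite fset_set_image // big_imfset //=.
by move=> x y; rewrite !in_fset_set //; exact: gi.
Qed.

Lemma card_fset_image (n m : nat) (A : set 'rV[R]_n) (g : 'rV[R]_n -> 'rV[R]_m) :
  finite_set A -> {in A &, injective g} ->
  #|` fset_set (g @` A)| = #|` fset_set A|.
Proof.
move=> fA gi; rewrite fset_set_image // card_in_imfset //=.
by move=> x y; rewrite !in_fset_set //; exact: gi.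
Qed.

Lemma card_fset_gt0 n (A : set 'rV[R]_n) : finite_set A -> A !=set0 ->
  0 < #|` fset_set A|%:R :> R.
Proof.
move=> fA [x Ax]; rewrite ltr0n cardfs_gt0; apply/eqP => A0.
by have := fset_set_set0 fA A0 => AE; rewrite AE in Ax.
Qed.

Lemma sum_fset_const n (A : set 'rV[R]_n) (c : R) :
  \sum_(x <- fset_set A) c = #|` fset_set A|%:R * c.
Proof. by rewrite big_const_seq count_predT iter_addr_0 mulr_natl. Qed.

Lemma eq_sum_fset n (A : set 'rV[R]_n) (T : nmodType) (f g : 'rV[R]_n -> T) :
  finite_set A -> (forall x, A x -> f x = g x) ->
  \sum_(x <- fset_set A) f x = \sum_(x <- fset_set A) g x.
Proof.
by move=> fA fg; apply: eq_big_seq => x; rewrite in_fset_set // => /set_mem/fg.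
Qed.

Lemma dot_barycentre n (A : set 'rV[R]_n) a :
  dot a (barycentre A) = #|` fset_set A|%:R^-1 * \sum_(x <- fset_set A) dot a x.
Proof. by rewrite dotZr dot_sumr. Qed.

Lemma form_barycentre n (A : set 'rV[R]_n) a e : finite_set A -> A !=set0 ->
  (forall x, A x -> dot a x = e) -> dot a (barycentre A) = e.
Proof.
move=> fA A0 ae; rewrite dot_barycentre (eq_sum_fset fA ae) sum_fset_const.
by rewrite mulKf // gt_eqF // card_fset_gt0.
Qed.

Lemma form_barycentre_lt n (A : set 'rV[R]_n) a e x : finite_set A -> A x ->
  (forall x, A x -> dot a x <= e) -> dot a x < e -> dot a (barycentre A) < e.
Proof.
move=> fA Ax ae xe; have A0 : 0 < #|` fset_set A|%:R :> R.
  by apply: card_fset_gt0 => //; exists x.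
rewrite dot_barycentre ltr_pdivrMl // -sum_fset_const.
have xA : x \in fset_set A by rewrite in_fset_set // mem_set.
rewrite (big_fsetD1 x) //= [X in _ < X](big_fsetD1 x) //=.
apply: ltr_leD => //; rewrite !big_seq; apply: ler_sum => y.
by rewrite !inE in_fset_set // => /andP[_ /set_mem/ae].
Qed.

(** Leibniz: the sum of the squared distances to the points of [A] exceeds its
    value at the barycentre by the squared distance to the barycentre, once for
    each point. *)
Lemma sum_sqr_dist n (A : set 'rV[R]_n) v : finite_set A -> A !=set0 ->
  \sum_(x <- fset_set A) edist x v ^+ 2
    = \sum_(x <- fset_set A) edist x (barycentre A) ^+ 2
      + #|` fset_set A|%:R * edist (barycentre A) v ^+ 2.
Proof.
move=> fA A0; have N0 := card_fset_gt0 fA A0.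
rewrite -sum_fset_const -big_split /=; apply/eqP; rewrite -subr_eq0 -sumrB.
have E (b x : 'rV[R]_n) : edist x v ^+ 2 - (edist x b ^+ 2 + edist b v ^+ 2)
    = 2 * (dot (b - v) x - dot (b - v) b).
  by rewrite !edist_sqr !dotE (dotC x v) (dotC x b) (dotC v b); ring.
rewrite (eq_sum_fset fA (fun x _ => E _ x)) -mulr_sumr sumrB sum_fset_const.
rewrite [X in _ - _ * X]dot_barycentre mulVKf ?lt0r_neq0 //.
by rewrite subrr mulr0.
Qed.

(** Hence the distance from a point to the barycentre of [A] is determined by
    the distances from that point to the points of [A], and is preserved by the
    isometries that preserve [A]. *)
Lemma barycentre_equidistant n (P A : set 'rV[R]_n) g v : finite_set A ->
  A !=set0 -> A `<=` P -> scaling 1 P P g -> g @` A = A -> P v ->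
  edist (barycentre A) (g v) = edist (barycentre A) v.
Proof.
move=> fA A0 AP sg gA Pv; have N0 := card_fset_gt0 fA A0.
apply: eqr_sqr; rewrite ?edist_ge0 //.
apply: (mulfI (lt0r_neq0 N0)).
have gi : {in A &, injective g}.
  by move=> x y /set_mem/AP Px /set_mem/AP Py; exact: scaling_inj sg Px Py.
have := sum_sqr_dist (g v) fA A0; rewrite -{1}gA sum_fset_image //.
rewrite (eq_sum_fset (g := fun x => edist x v ^+ 2)) //.
  by rewrite (sum_sqr_dist v fA A0) => /addrI.
by case: sg => _ gE _ x /AP Px; rewrite gE // mul1r.
Qed.

(** The circumradius is a function of the mutual distances, so similarities
    multiply it by their ratio. *)
Lemma circumradius n (A : set 'rV[R]_n) (rho : R) : finite_set A -> A !=set0 ->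
  (forall v, A v -> edist (barycentre A) v ^+ 2 = rho) ->
  \sum_(x <- fset_set A) \sum_(y <- fset_set A) edist y x ^+ 2
    = 2 * #|` fset_set A|%:R ^+ 2 * rho.
Proof.
move=> fA A0 rhoE.
rewrite (eq_sum_fset (g := fun _ => 2 * #|` fset_set A|%:R * rho)) //.
  by rewrite sum_fset_const; ring.
move=> v Av; rewrite sum_sqr_dist // (rhoE _ Av).
rewrite (eq_sum_fset (g := fun _ => rho)) // ?sum_fset_const; first by ring.
by move=> x Ax; rewrite edistC rhoE.
Qed.

Lemma circumradius_scaling r n m (P A : set 'rV[R]_n) (Q : set 'rV[R]_m)
    (phi : 'rV[R]_n -> 'rV[R]_m) (rho rho' : R) :
  finite_set A -> A !=set0 -> A `<=` P -> scaling r P Q phi ->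
  (forall v, A v -> edist (barycentre A) v ^+ 2 = rho) ->
  (forall v, A v -> edist (barycentre (phi @` A)) (phi v) ^+ 2 = rho') ->
  rho' = r ^+ 2 * rho.
Proof.
move=> fA A0 AP sP rhoE rho'E; have N0 := card_fset_gt0 fA A0.
have pi : {in A &, injective phi}.
  by move=> x y /set_mem/AP Px /set_mem/AP Py; exact: scaling_inj sP Px Py.
have A'0 : phi @` A !=set0 by case: A0 => x Ax; exists (phi x), x.
have A'E y : (phi @` A) y -> edist (barycentre (phi @` A)) y ^+ 2 = rho'.
  by move=> [x Ax <-]; exact: rho'E.
have E := circumradius (finite_image phi fA) A'0 A'E.
rewrite sum_fset_image // card_fset_image // in E.
have E' := circumradius fA A0 rhoE.
apply: (mulfI (_ : 2 * #|` fset_set A|%:R ^+ 2 != 0)).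
  by rewrite mulf_neq0 ?expf_neq0 ?lt0r_neq0.
rewrite -E mulrCA -E' mulr_sumr; apply: eq_sum_fset => // x Ax.
rewrite sum_fset_image // mulr_sumr; apply: eq_sum_fset => // y Ay.
by case: sP => _ -> //; rewrite ?exprMn //; exact: AP.
Qed.

End Barycentres.

(** * Edge-scribed polytopes *)

Section Tangency.
Variable R : realType.
Implicit Types n m k : nat.

Lemma edge_segment_ends n (e : set 'rV[R]_n) u v x : is_hull e -> has_dim e 1 ->
  vertices e = [set u; v] -> u != v -> e x ->
  exists t : R, 0 <= t <= 1 /\ x = u + t *: (v - u).
Proof.
move=> he de eE uv ex; have [u' [v' [_ eE' /(_ x ex)[t [t01 xE]]]]] := edge_segment he de.
have : vertices e u by rewrite eE; left.
have : vertices e v by rewrite eE; right.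
rewrite eE' => -[/= vE|/= vE] [/= uE|/= uE].
- by rewrite uE vE eqxx in uv.
- exists (1 - t); split; first by lra.
  by rewrite xE uE vE; apply/rowP => i; rewrite !mxE; ring.
- by exists t; rewrite uE vE.
- by rewrite uE vE eqxx in uv.
Qed.

Lemma tangent_sqr n (e : set 'rV[R]_n) p x : tangent_at e p -> e x ->
  edist x p ^+ 2 = dot x x - 1.
Proof.
move=> [ep np tp] ex; have pp : dot p p = 1 by rewrite -enorm_sqr np expr1n.
have := tp x ex; rewrite edist_sqr !dotE pp (dotC x p); lra.
Qed.

Lemma tangent_length n (e : set 'rV[R]_n) p x : tangent_at e p -> e x ->
  edist x p = Num.sqrt (dot x x - 1).
Proof. by move=> tp ex; rewrite -(tangent_sqr tp ex) sqrtr_sqr ger0_norm ?edist_ge0. Qed.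

Lemma edist_segment n (u v : 'rV[R]_n) t : 0 <= t <= 1 ->
  edist u (u + t *: (v - u)) = t * edist u v /\
  edist v (u + t *: (v - u)) = (1 - t) * edist u v.
Proof.
move=> /andP[t0 t1]; split; apply: eqr_sqr; rewrite ?edist_ge0 ?mulr_ge0 ?edist_ge0 ?subr_ge0 //.
  by rewrite exprMn !edist_sqr !dotE (dotC v u); ring.
by rewrite exprMn !edist_sqr !dotE (dotC v u); ring.
Qed.

Lemma tangent_edge n (e : set 'rV[R]_n) p u v : is_hull e -> has_dim e 1 ->
  vertices e = [set u; v] -> u != v -> tangent_at e p ->
  Num.sqrt (dot u u - 1) + Num.sqrt (dot v v - 1) = edist u v /\
  (dot u u = dot v v -> p = 2^-1 *: (u + v)).
Proof.
move=> he de eE uv tp; have [ep _ _] := tp.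
have [t [t01 pE]] := edge_segment_ends he de eE uv ep.
have eu : e u by apply: vertices_sub; rewrite eE; left.
have ev : e v by apply: vertices_sub; rewrite eE; right.
have [] := edist_segment u v t01.
rewrite -pE (tangent_length tp eu) (tangent_length tp ev) => hu hv.
rewrite hu hv; split; first by ring.
move=> uvE; have : t * edist u v = (1 - t) * edist u v by rewrite -hu -hv uvE.
move/(mulIf (_ : edist u v != 0)); rewrite edist_eq0 => /(_ uv) tE.
by rewrite pE (_ : t = 2^-1); [apply/rowP => i; rewrite !mxE; field|lra].
Qed.

(** As the vertices lie on a circle, [|x|^2] is an affine function of the
    vertex [x]; let it be maximal at [X] and minimal at [Y]. The tangent lengths of
    adjacent vertices add up to the common edge length [L]. So every tangent length,
    being [L] minus that of a neighbour, is at least [L] minus that of [X], which is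
    the value at the neighbours of [X]: these attain the minimum. Were the two extreme values
    different, the two neighbours would span the face where the minimum is
    attained, an edge both of whose tangent lengths are minimal: too short. *)
Lemma polygon_equal_norms n (F : set 'rV[R]_n) c : is_hull F -> has_dim F 2 ->
  edge_scribed F -> equilateral F ->
  (forall u v, vertices F u -> vertices F v -> edist c u = edist c v) ->
  forall u v, vertices F u -> vertices F v -> dot u u = dot v v.
Proof.
move=> hF dF tF eqF cF.
have F0 := has_dim_inhabited dF.
have [X XF XM] := hull_form_max c hF F0.
have [Y YF Ym] := hull_form_min c hF F0.
have sq x y : vertices F x -> vertices F y ->
    dot x x - 2 * dot c x = dot y y - 2 * dot c y.
  move=> xF yF; have := cF _ _ xF yF => /(congr1 (fun z => z ^+ 2)).
  by rewrite !edist_sqr !dotE (dotC x c) (dotC y c); lra.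
have [XY|YX] := leP (dot c X) (dot c Y).
  move=> u v uF vF; have := sq _ _ uF vF.
  have := XM _ (vertices_sub uF); have := XM _ (vertices_sub vF).
  have := Ym _ (vertices_sub uF); have := Ym _ (vertices_sub vF).
  by lra.
exfalso; pose tl (x : 'rV[R]_n) := Num.sqrt (dot x x - 1).
have edge_tl e x y : edge F e -> x != y -> vertices e = [set x; y] ->
    tl x + tl y = edist x y.
  move=> eF xy eE; have [p tp] := tF _ eF.
  by have [] := tangent_edge (face_hull hF eF.1) eF.2 eE xy tp.
have vertex_ge1 x : vertices F x -> 0 <= dot x x - 1.
  move=> xF; have [e [y [eF xy eE]]] := edge_at hF dF isT xF.
  have [p tp] := tF _ eF.
  rewrite -(tangent_sqr (x := x) tp) ?sqr_ge0 //.
  by apply: vertices_sub; rewrite eE; left.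
have tl_le x y : vertices F x -> vertices F y -> dot c x <= dot c y -> tl x <= tl y.
  by move=> xF yF xy; rewrite ler_wsqrtr //; have := sq _ _ xF yF; lra.
have tl_inj x y : vertices F x -> vertices F y -> tl x = tl y -> dot c x = dot c y.
  move=> xF yF /eqP; rewrite eqr_sqrt ?vertex_ge1 // => /eqP.
  by have := sq _ _ xF yF; lra.
have [e1 [e2 [y1 [y2 [[e1F Xy1 e1E] [e2F Xy2 e2E] y12]]]]] := polygon_two_edges hF dF XF.
have [e3 [z [e3F Yz e3E]]] := edge_at hF dF isT YF.
have vF e x y : edge F e -> vertices e = [set x; y] -> vertices F y.
  move=> eF eE; have : vertices e y by rewrite eE; right.
  by rewrite (face_vertices hF eF.1) => -[].
have y1F := vF _ _ _ e1F e1E; have y2F := vF _ _ _ e2F e2E; have zF := vF _ _ _ e3F e3E.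
have L1 := edge_tl _ _ _ e1F Xy1 e1E; have L2 := edge_tl _ _ _ e2F Xy2 e2E.
have L3 := edge_tl _ _ _ e3F Yz e3E.
have L12 := eqF _ _ _ _ _ _ e1F e2F Xy1 Xy2 e1E e2E.
have L13 := eqF _ _ _ _ _ _ e1F e3F Xy1 Yz e1E e3E.
have zX := tl_le _ _ zF XF (XM _ (vertices_sub zF)).
have Yy1 := tl_le _ _ YF y1F (Ym _ (vertices_sub y1F)).
have y1Y : tl y1 = tl Y by lra.
have y2Y : tl y2 = tl Y by lra.
have cy1 := tl_inj _ _ y1F YF y1Y; have cy2 := tl_inj _ _ y2F YF y2Y.
pose G := [set x | F x /\ dot (- c) x = - dot c Y].
have fG : face F G.
  by exists (- c), (- dot c Y); split=> // x Fx; rewrite dotNl lerN2 Ym.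
have Gy1 : G y1 by split; [exact: vertices_sub|rewrite dotNl cy1].
have Gy2 : G y2 by split; [exact: vertices_sub|rewrite dotNl cy2].
have GF : G <> F.
  move=> GF; have : G X by rewrite GF; exact: vertices_sub.
  by case=> _; rewrite dotNl; lra.
have gF := polygon_edge dF fG GF Gy1 Gy2 (elimN eqP y12).
have [u [v [uv GE _]]] := edge_segment (face_hull hF fG) gF.2.
have GE' : vertices G = [set y1; y2].
  have : vertices G y1 by rewrite (face_vertices hF fG).
  have : vertices G y2 by rewrite (face_vertices hF fG).
  rewrite GE => -[/= y2E|/= y2E] [/= y1E|/= y1E]; rewrite y1E y2E in y12 *.
  - by rewrite eqxx in y12.
  - by rewrite setUC.
  - by [].
  - by rewrite eqxx in y12.
have L4 := edge_tl _ _ _ gF y12 GE'.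
have L14 := eqF _ _ _ _ _ _ e1F gF Xy1 y12 e1E GE'.
have XYt : tl X = tl Y by lra.
by have := tl_inj _ _ XF YF XYt; lra.
Qed.

Lemma isogonal_equidistant n (P : set 'rV[R]_n) u v : is_hull P -> isogonal P ->
  vertices P u -> vertices P v ->
  edist (barycentre (vertices P)) u = edist (barycentre (vertices P)) v.
Proof.
move=> hP isoP uP vP; have [g sg <-] := isoP _ _ uP vP.
rewrite (barycentre_equidistant (P := P) (g := g)) //.
- exact: finite_vertices.
- by exists u.
- exact: vertices_sub.
- by rewrite -(scaling_vertices sg).
- exact: vertices_sub.
Qed.

(** If two points are each equidistant from the vertices, here [c] and the origin,
    their difference is orthogonal to the differences of vertices. *)
Lemma center_form n (F : set 'rV[R]_n) (N : R) c : is_hull F ->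
  (forall v, vertices F v -> dot v v = N) ->
  (forall u v, vertices F u -> vertices F v -> edist c u = edist c v) ->
  forall x y, F x -> F y -> dot c x = dot c y.
Proof.
move=> hF nF cF x y Fx Fy.
have [v vF] := hull_vertex hF (ex_intro _ x Fx).
have E w : vertices F w -> dot c w = dot c v.
  move=> wF; have := cF _ _ wF vF => /(congr1 (fun z => z ^+ 2)).
  by rewrite !edist_sqr !dotE (dotC w c) (dotC v c) (nF _ wF) (nF _ vF); lra.
by rewrite !(form_const hF E).
Qed.

(** Edge-scribed and homogeneous, with the metric consequences of both; [t] is
    half the common edge length. Faces of dimension at least 2 inherit this
    property with the same [t]; the sphere that touches their edges within their
    affine hull is the section of the unit sphere. *)
Record midscribed n k (P : set 'rV[R]_n) (t : R) : Prop := Midscribed {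
  mid_hull : is_hull P;
  mid_dim : has_dim P k;
  mid_ge2 : (2 <= k)%N;
  mid_homogeneous : homogeneous P;
  mid_gt0 : 0 < t;
  mid_norm : forall v, vertices P v -> dot v v = 1 + t ^+ 2;
  mid_edge : forall e u v, edge P e -> vertices e = [set u; v] -> u != v ->
    edist u v = 2 * t /\ forall p, tangent_at e p <-> p = 2^-1 *: (u + v)
}.

(** Every edge lies in a polygonal face, so by [polygon_equal_norms] its endpoints
    have equal norms and it is touched at its midpoint; a symmetry moving one
    vertex to another carries an edge at the first to an edge at the second, so
    all norms, and with them all edge lengths, agree. *)
Lemma edge_scribed_midscribed n k (P : set 'rV[R]_n) :
  is_hull P -> has_dim P k -> (2 <= k)%N -> edge_scribed P -> homogeneous P ->
  exists t : R, midscribed k P t.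
Proof.
move=> hP dP k2 tP HP.
have P0 := has_dim_inhabited dP.
have eqn e u v : edge P e -> vertices e = [set u; v] -> dot u u = dot v v.
  move=> eP eE; have [F fF eF] := kface_up_to (i := 2) hP dP eP k2.
  have hF := face_hull hP fF.1.
  have [isoF /(_ erefl) eqF] := HP _ _ (leqnn 2) fF.
  have eF' : face F e := face_restrict eP.1 eF (face_sub fF.1).
  apply: (polygon_equal_norms hF fF.2 _ eqF (c := barycentre (vertices F))).
  - by move=> e' e'F; apply: tP; exact: kface_trans hP fF e'F.
  - by move=> x y xF yF; exact: isogonal_equidistant.
  - have : vertices e u by rewrite eE; left.
    by rewrite (face_vertices hF eF') => -[].
  - have : vertices e v by rewrite eE; right.
    by rewrite (face_vertices hF eF') => -[].
have len e u v : edge P e -> vertices e = [set u; v] -> u != v ->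
    dot u u = 1 + (edist u v / 2) ^+ 2 /\
    forall p, tangent_at e p <-> p = 2^-1 *: (u + v).
  move=> eP eE uv; have [p tp] := tP _ eP; have he := face_hull hP eP.1.
  have uvE := eqn _ _ _ eP eE.
  have mid q : tangent_at e q -> q = 2^-1 *: (u + v).
    by move=> tq; have [_ ->] := tangent_edge he eP.2 eE uv tq.
  split; last first.
    by move=> q; split=> [/mid//|->]; rewrite -(mid _ tp).
  have eu : e u by apply: vertices_sub; rewrite eE; left.
  have [<- _] := tangent_edge he eP.2 eE uv tp.
  rewrite -uvE -mulr2n -[_ *+ 2]mulr_natr mulfK ?pnatr_eq0 // -(tangent_length tp eu).
  by rewrite (tangent_sqr tp eu); ring.
have [v0 v0P] := hull_vertex hP P0.
have [e0 [w0 [e0P vw0 e0E]]] := edge_at hP dP (ltnW k2) v0P.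
pose t := edist v0 w0 / 2.
have isoP : isogonal P by case: (HP _ _ k2 (conj (face_refl P) dP)).
have nP v : vertices P v -> dot v v = 1 + t ^+ 2.
  move=> vP; have [g sg gv] := isoP _ _ v0P vP.
  have se := scaling_sub sg (face_sub e0P.1).
  have ge := scaling_kface sg e0P.
  have gE : vertices (g @` e0) = [set v; g w0].
    by rewrite (scaling_vertices se) e0E image_setU !image_set1 gv.
  have e0v : e0 v0 by apply: vertices_sub; rewrite e0E; left.
  have e0w : e0 w0 by apply: vertices_sub; rewrite e0E; right.
  have vw : v != g w0.
    by apply: contra vw0 => /eqP; rewrite -gv => /(scaling_inj se e0v e0w) ->.
  have [-> _] := len _ _ _ ge gE vw; congr (1 + (_ / 2) ^+ 2).
  by rewrite -gv; case: se => _ -> //; rewrite mul1r.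
have t0 : 0 < t by rewrite divr_gt0 ?edist_gt0.
exists t; split=> // e u v eP eE uv; have [uE tE] := len _ _ _ eP eE uv.
split=> //.
have : vertices e u by rewrite eE; left.
rewrite (face_vertices hP eP.1) => -[uP _].
have /eqP := nP _ uP; rewrite uE => /eqP /addrI.
move=> h; have : edist u v / 2 = t.
  by apply: eqr_sqr h; [rewrite divr_ge0 ?edist_ge0|exact: ltW].
by lra.
Qed.

End Tangency.

(** * Centres of the faces of a flag *)

Section FlagCenters.
Variable R : realType.
Implicit Types n m k : nat.

Definition center n (F : set 'rV[R]_n) : 'rV[R]_n := barycentre (vertices F).

Lemma barycentre_pair n (u v : 'rV[R]_n) : u != v ->
  barycentre [set u; v] = 2^-1 *: (u + v).
Proof.
move=> uv; rewrite /barycentre fset_setU ?fset_set1 //; try exact: finite_set1.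
by rewrite cardfs2 uv big_fsetU1 ?inE //= big_seq_fset1.
Qed.

Lemma full_dim_form n (Q : set 'rV[R]_n) b : has_dim Q n ->
  (forall x y, Q x -> Q y -> dot b x = dot b y) -> b = 0.
Proof.
move=> [x0 [B [Bf Qx0 QB _]]] bQ; apply/eqP; rewrite -dot_eq0; apply/eqP.
apply: (@dot_span _ _ _ B) => [i|].
  by have := bQ _ _ (QB i) Qx0; rewrite dotDr; lra.
by rewrite submx_full // row_full_unit -row_free_unit.
Qed.

Lemma barycentre_submx n m (P A : set 'rV[R]_n) (B : 'M[R]_(m, n)) x0 :
  finite_set A -> A !=set0 -> (forall x, A x -> (x - x0 <= B)%MS) ->
  (barycentre A - x0 <= B)%MS.
Proof.
move=> fA A0 AB; have N0 := card_fset_gt0 fA A0.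
have -> : barycentre A - x0
    = #|` fset_set A|%:R^-1 *: \sum_(x <- fset_set A) (x - x0).
  rewrite sumrB scalerBr; congr (_ - _).
  rewrite big_const_seq count_predT iter_addr_0 -scaler_nat scalerA.
  by rewrite mulVf ?scale1r // lt0r_neq0.
rewrite scalemx_sub // big_seq; apply: summx_sub => x.
by rewrite in_fset_set // => /set_mem/AB.
Qed.

Lemma orthonormal_dot n k (E : 'M[R]_(k, n)) x y : E *m E^T = 1%:M ->
  (x <= E)%MS -> (y <= E)%MS -> dot (x *m E^T) (y *m E^T) = dot x y.
Proof.
move=> EE /submxP[w ->] /submxP[z ->].
by rewrite -!(mulmxA _ E) EE !mulmx1 !dot_mx trmx_mul mulmxA -(mulmxA w) EE mulmx1.
Qed.

Section Flag.
Variables (n k : nat) (P : set 'rV[R]_n) (F : nat -> set 'rV[R]_n) (t : R).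
Hypotheses (mP : midscribed k P t) (fF : flag k P F).

Let hP := mid_hull mP.
Let k2 := mid_ge2 mP.
Local Notation c i := (center (F i)).

Lemma flag_face i : (i <= k)%N -> kface i P (F i).
Proof. by case: fF => h _ _ ik; exact: h. Qed.

Lemma flag_sub i j : (i <= j)%N -> (j <= k)%N -> F i `<=` F j.
Proof.
have [_ sF _] := fF; elim: j => [|j IH]; first by rewrite leqn0 => /eqP -> _ x.
rewrite leq_eqVlt => /predU1P[-> _ x //|ij] jk x /(IH ij (ltnW jk)); exact: sF.
Qed.

Lemma flag_vertices_sub i : (i <= k)%N -> vertices (F i) `<=` vertices P.
Proof. by move=> /flag_face[fi _]; rewrite (face_vertices hP fi) => x []. Qed.

Lemma flag_finite i : (i <= k)%N -> finite_set (vertices (F i)).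
Proof. by move=> /flag_face[fi _]; apply: finite_vertices; exact: face_hull fi. Qed.

Lemma flag_inhabited i : (i <= k)%N -> vertices (F i) !=set0.
Proof.
move=> /flag_face[fi di]; have [v vF] := hull_vertex (face_hull hP fi) (has_dim_inhabited di).
by exists v.
Qed.

Lemma flag_edge : exists u v, [/\ u != v, vertices (F 1%N) = [set u; v],
  c 1%N = 2^-1 *: (u + v) & tangent_at (F 1%N) (c 1%N)].
Proof.
have [f1 d1] := flag_face (ltnW k2).
have [u [v [uv eE _]]] := edge_segment (face_hull hP f1) d1.
have cE : c 1%N = 2^-1 *: (u + v) by rewrite /center eE barycentre_pair.
have [_ tE] := mid_edge mP (conj f1 d1) eE uv.
by exists u, v; split=> //; apply/tE.
Qed.

Lemma flag_center_equidistant i u v : (i <= k)%N ->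
  vertices (F i) u -> vertices (F i) v -> edist (c i) u = edist (c i) v.
Proof.
move=> ik uF vF; have [fi di] := flag_face ik; have hi := face_hull hP fi.
case: i => [|[|i]] in ik uF vF fi di hi *.
- have Fu := vertices_sub uF; have := vertices_sub vF.
  by rewrite (has_dim0 di Fu) => ->.
- have [x [y [xy eE cE _]]] := flag_edge.
  have E : edist (c 1%N) x = edist (c 1%N) y.
    by apply: eqr_sqr; rewrite ?edist_ge0 // !edist_sqr cE !dotE (dotC y x); field.
  by move: uF vF; rewrite eE => -[/= ->|/= ->] [/= ->|/= ->].
- have [isoF _] : isogonal (F i.+2) /\ _ := mid_homogeneous mP (isT : (2 <= i.+2)%N) (conj fi di).
  exact: isogonal_equidistant.
Qed.

(** The centre of [F i] and the origin are both equidistant from the vertices of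
    [F i], so the centre is the foot of the perpendicular from the origin. *)
Lemma flag_center_form i x y : (i <= k)%N -> F i x -> F i y ->
  dot (c i) x = dot (c i) y.
Proof.
move=> ik; apply: (center_form (N := 1 + t ^+ 2)).
- by have [fi _] := flag_face ik; exact: face_hull fi.
- by move=> v /(flag_vertices_sub ik)/(mid_norm mP).
- by move=> u v; exact: flag_center_equidistant.
Qed.

Lemma flag_center_dot i x : (i <= k)%N -> F i x -> dot (c i) x = dot (c i) (c i).
Proof.
move=> ik Fx; apply/esym/form_barycentre.
- exact: flag_finite.
- exact: flag_inhabited.
- by move=> y /vertices_sub Fy; exact: flag_center_form.
Qed.

Lemma flag_centers_dot i j : (i <= j)%N -> (j <= k)%N ->
  dot (c j) (c i) = dot (c j) (c j).
Proof.
move=> ij jk; have ik := leq_trans ij jk; apply: form_barycentre.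
- exact: flag_finite.
- exact: flag_inhabited.
- move=> y /vertices_sub Fy; apply: flag_center_dot => //.
  exact: flag_sub Fy.
Qed.

Definition gap i := c i - c i.+1.

Lemma gap_sqr i : (i < k)%N ->
  dot (gap i) (gap i) = dot (c i) (c i) - dot (c i.+1) (c i.+1).
Proof.
move=> ik; have := flag_centers_dot (leqnSn i) ik.
rewrite /gap; move: (c i) (c i.+1) => x y.
by rewrite !dotE (dotC x y); lra.
Qed.

(** The later gap is orthogonal to the face [F j], which contains both centres that
    bound the earlier one. *)
Lemma gap_orthogonal i j : (i < j)%N -> (j < k)%N -> dot (gap j) (gap i) = 0.
Proof.
move=> ij jk; have ji := ltnW ij; have jk' := ltnW jk.
rewrite /gap dotDl dotNl !dotDr !dotNr.
rewrite (flag_centers_dot ji jk') (flag_centers_dot ij jk').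
rewrite (@flag_centers_dot i j.+1) ?(leqW ji) //.
by rewrite (@flag_centers_dot i.+1 j.+1) ?(leqW ij) //; lra.
Qed.

(** The form exposing [F i] takes a smaller value at some vertex of the next
    face, hence at its centre. *)
Lemma gap_gt0 i : (i < k)%N -> 0 < dot (gap i) (gap i).
Proof.
move=> ik; rewrite dot_gt0 subr_eq0; apply/eqP => cE.
have [fi di] := flag_face (ltnW ik); have [fj dj] := flag_face ik.
have [a [e [ae aF aP]]] := face_strict fi.
have [v vF vm] := hull_form_min a (face_hull hP fj) (has_dim_inhabited dj).
have Fv := vertices_sub vF.
have lt : dot a v < e.
  apply: (aP) => [|Fiv]; first exact: face_sub fj _ Fv.
  have /(has_dim_uniq di) : has_dim (F i) i.+1.
    rewrite (_ : F i = F i.+1) //; apply/seteqP; split.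
      exact: flag_sub.
    move=> x Fx; apply: contrapT => nFx.
    have := aP x (face_sub fj Fx) nFx; have := vm x Fx; rewrite (aF v Fiv).
    by move=> h1 h2; have := le_lt_trans h1 h2; rewrite ltxx.
  by move/eqP; rewrite ltn_eqF.
have h : dot a (c i) = e.
  apply: form_barycentre; [exact: flag_finite (ltnW ik)|exact: flag_inhabited (ltnW ik)|].
  by move=> x /vertices_sub/aF.
have ae' x : vertices (F i.+1) x -> dot a x <= e.
  by move=> /vertices_sub/(face_sub fj); exact: ae.
have := form_barycentre_lt (flag_finite ik) vF ae' lt.
by rewrite -/(center _) -cE h ltxx.
Qed.

Lemma flag_center0 : dot (c 0%N) (c 0%N) = 1 + t ^+ 2.
Proof.
have [f0 d0] := flag_face (leq0n k).
have [v vF] := flag_inhabited (leq0n k).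
have Fv := vertices_sub vF.
have -> : c 0%N = v; last first.
  by apply: (mid_norm mP); apply: flag_vertices_sub vF.
rewrite /center (_ : vertices (F 0%N) = [set v]).
  by rewrite /barycentre fset_set1 cardfs1 big_seq_fset1 invr1 scale1r.
by apply/seteqP; split=> [w /vertices_sub|w ->//]; rewrite (has_dim0 d0 Fv).
Qed.

Lemma flag_center1 : dot (c 1%N) (c 1%N) = 1.
Proof. by have [u [v [_ _ _ [_ n1 _]]]] := flag_edge; rewrite -enorm_sqr n1 expr1n. Qed.

Lemma flag_center_le i j : (i <= j)%N -> (j <= k)%N ->
  dot (c j) (c j) <= dot (c i) (c i).
Proof.
move=> ij; rewrite -(subnK ij) addnC; elim: (j - i)%N => [|l IH]; rewrite ?addn0 // addnS.
move=> lk; apply: le_trans (IH (ltnW lk)); rewrite -subr_ge0 -gap_sqr // ltW //.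
exact: gap_gt0.
Qed.

Lemma flag_center_lt1 i : (1 < i)%N -> (i <= k)%N -> dot (c i) (c i) < 1.
Proof.
move=> i1 ik; apply: le_lt_trans (flag_center_le i1 ik) _.
by rewrite -flag_center1 -subr_gt0 -gap_sqr ?gap_gt0.
Qed.

Definition frame m : 'M[R]_(m, n) := \matrix_(i < m) ((enorm (gap i))^-1 *: gap i).

Lemma frame_orthonormal : frame k *m (frame k)^T = 1%:M.
Proof.
apply/matrixP => i j.
have -> : (frame k *m (frame k)^T) i j = dot (row i (frame k)) (row j (frame k)).
  by rewrite mxE; apply: eq_bigr => l _; rewrite !mxE.
rewrite !rowK dotZl dotZr [RHS]mxE.
have [->|ij] := eqVneq i j.
  have := gap_gt0 (ltn_ord j); rewrite -enorm_sqr => g0.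
  have gn : enorm (gap j) != 0 by rewrite -sqrf_eq0 gt_eqF.
  by rewrite (_ : true%:R = 1) //; field.
have : (i < j)%N \/ (j < i)%N.
  by apply/orP; rewrite -neq_ltn; apply: contra ij => /eqP/val_inj/eqP.
case=> ltij; last by rewrite gap_orthogonal // !mulr0.
by rewrite dotC gap_orthogonal // !mulr0.
Qed.

(** There are as many gaps as the dimension of [P], so they span its direction. *)
Lemma frame_span x : P x -> (x - c k <= frame k)%MS.
Proof.
move=> Px; have [x0 [B [Bf Px0 PB PsB]]] := mid_dim mP.
have PE : F k = P by case: fF.
have cB i : (i <= k)%N -> (c i - x0 <= B)%MS.
  move=> ik; apply: barycentre_submx => //; first exact: flag_finite.
    exact: flag_inhabited.
  by move=> y /vertices_sub /(flag_sub ik (leqnn k)); rewrite PE; exact: PsB.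
have sub (y z : 'rV[R]_n) : (y - x0 <= B)%MS -> (z - x0 <= B)%MS -> (y - z <= B)%MS.
  move=> yB zB; have -> : y - z = (y - x0) - (z - x0) by rewrite opprB addrA subrK.
  by rewrite addmx_sub ?eqmx_opp.
have EB : (frame k <= B)%MS.
  apply/row_subP => i; rewrite rowK scalemx_sub // sub // cB //.
  exact: ltnW.
have Ef : row_free (frame k) by apply/row_freeP; exists (frame k)^T; exact: frame_orthonormal.
have /eqmxP E : (frame k == B)%MS.
  by rewrite -(mxrank_leqif_eq EB) (eqP Bf) (eqP Ef).
by rewrite E; apply: sub; [exact: PsB|exact: cB].
Qed.

End Flag.

End FlagCenters.

(** * Canonical lengths *)

Section CanonicalLength.
Variable R : realType.
Implicit Types n m k : nat.

(** Weights indexed by [nat] make the length of the list irrelevant to their type,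
    so that [size_map] can be rewritten. *)
Lemma conv_hull_nat n (s : seq 'rV[R]_n) x : conv_hull s x <->
  exists w : nat -> R, [/\ forall i, 0 <= w i, \sum_(i < size s) w i = 1
    & x = \sum_(i < size s) w i *: s`_i].
Proof.
split=> [[w [w0 w1 ->]]|[w [w0 w1 ->]]]; last by exists (fun i => w i).
exists (fun i => oapp w 0 (insub i)); split=> [i||].
- by case: insub => //=; rewrite lexx.
- by rewrite -w1; apply: eq_bigr => i _; rewrite valK.
- by apply: eq_bigr => i _; rewrite valK.
Qed.

Lemma is_hull_affine n m (P : set 'rV[R]_n) c (M : 'M[R]_(n, m)) :
  is_hull P -> is_hull ((fun x => (x - c) *m M) @` P).
Proof.
move=> [s ->]; set f := fun x => _; exists (map f s).
have fE (w : nat -> R) : \sum_(i < size s) w i = 1 ->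
    f (\sum_(i < size s) w i *: s`_i) = \sum_(i < size s) w i *: (map f s)`_i.
  move=> w1; rewrite /f -[c in _ - c]scale1r -w1 scaler_suml -sumrB mulmx_suml.
  apply: eq_bigr => i _.
  by rewrite (nth_map 0) // -scalerBr -scalemxAl.
apply/seteqP; split=> [_ [x /conv_hull_nat [w [w0 w1 ->]] <-]|y].
  by apply/conv_hull_nat; exists w; rewrite size_map fE.
move=> /conv_hull_nat; rewrite size_map => -[w [w0 w1 ->]].
exists (\sum_(i < size s) w i *: s`_i); last exact: fE.
by apply/conv_hull_nat; exists w.
Qed.

Lemma scaling_midpoint r n m (P : set 'rV[R]_n) (Q : set 'rV[R]_m)
    (phi : 'rV[R]_n -> 'rV[R]_m) u v : scaling r P Q phi -> P u -> P v ->
  P (2^-1 *: (u + v)) -> phi (2^-1 *: (u + v)) = 2^-1 *: (phi u + phi v).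
Proof.
move=> sP Pu Pv Pp; have p2 := scaling_dot sP Pp Pu Pu.
have p3 := scaling_dot sP Pp Pv Pv; have p4 := scaling_dot sP Pp Pu Pv.
apply/eqP; rewrite -subr_eq0 -dot_eq0; apply/eqP.
move: p2 p3 p4.
have -> : dot (phi (2^-1 *: (u + v)) - 2^-1 *: (phi u + phi v))
     (phi (2^-1 *: (u + v)) - 2^-1 *: (phi u + phi v)) =
   4^-1 * (dot (phi u - phi (2^-1 *: (u + v))) (phi u - phi (2^-1 *: (u + v))) +
   dot (phi v - phi (2^-1 *: (u + v))) (phi v - phi (2^-1 *: (u + v))) +
   2 * dot (phi u - phi (2^-1 *: (u + v))) (phi v - phi (2^-1 *: (u + v)))).
  move: (phi u) (phi v) (phi _) => a b d.
  by rewrite !dotE (dotC b a) (dotC d a) (dotC d b); field.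
move=> -> -> ->.
by rewrite !dotE (dotC v u); field.
Qed.

(** In full dimension the vertices determine their circumcentre. *)
Lemma equidistant_eq0 n (Q : set 'rV[R]_n) (N : R) b : is_hull Q -> has_dim Q n ->
  (forall v, vertices Q v -> dot v v = N) ->
  (forall u v, vertices Q u -> vertices Q v -> edist b u = edist b v) -> b = 0.
Proof.
move=> hQ dQ nQ bQ; apply: (full_dim_form dQ) => x y.
exact: (center_form hQ nQ bQ).
Qed.

(** The points of tangency are permuted by the symmetries of [Q], so their
    barycentre is equidistant from the vertices, as is the origin. *)
Lemma midscribed_canonical k (Q : set 'rV[R]_k) : is_hull Q -> has_dim Q k ->
  (2 <= k)%N -> edge_scribed Q -> homogeneous Q -> Defs.canonical Q.
Proof.
move=> hQ dQ k2 tQ HQ; split=> //.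
have [t [_ _ _ _ t0 nQ eQ]] := edge_scribed_midscribed hQ dQ k2 tQ HQ.
have isoQ : isogonal Q by case: (HQ _ _ k2 (conj (face_refl Q) dQ)).
set T := tangency_points Q.
have TP p : T p <-> exists e u v, [/\ edge Q e, u != v, vertices e = [set u; v]
    & p = 2^-1 *: (u + v)].
  split=> [[e eE tp]|[e [u [v [eE uv vE ->]]]]].
    have [u [v [uv vE _]]] := edge_segment (face_hull hQ eE.1) eE.2.
    by exists e, u, v; split=> //; have [_ /(_ p)[+ _]] := eQ _ _ _ eE vE uv; apply.
  by exists e => //; have [_ tE] := eQ _ _ _ eE vE uv; apply/tE.
have TQ : T `<=` Q by move=> p [e [fe _] [ep _ _]]; exact: face_sub fe _ ep.
have fT : finite_set T.
  apply: (@sub_finite_set _ _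
    ((fun uv => 2^-1 *: (uv.1 + uv.2)) @` (vertices Q `*` vertices Q))).
    move=> p /TP[e [u [v [eE uv vE ->]]]]; exists (u, v) => //.
    have : vertices e u by rewrite vE; left.
    have : vertices e v by rewrite vE; right.
    by rewrite (face_vertices hQ eE.1) => -[vQ _] [uQ _]; split.
  by apply: finite_image; apply: finite_setX; exact: finite_vertices.
have T0 : T !=set0.
  have [v vQ] := hull_vertex hQ (has_dim_inhabited dQ).
  have [e [w [eE vw vE]]] := edge_at hQ dQ (ltnW k2) vQ.
  by exists (2^-1 *: (v + w)); apply/TP; exists e, v, w.
have gT g : scaling 1 Q Q g -> g @` T `<=` T.
  move=> sg _ [p Tp <-]; have Qp := TQ _ Tp.
  case/TP: Tp => e [u [v [eE uv vE pE]]]; apply/TP.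
  have sub := scaling_sub sg (face_sub eE.1).
  have eu : e u by apply: vertices_sub; rewrite vE; left.
  have ev : e v by apply: vertices_sub; rewrite vE; right.
  exists (g @` e), (g u), (g v); split.
  - exact: scaling_kface sg eE.
  - by apply: contra uv => /eqP /(scaling_inj sub eu ev) ->.
  - by rewrite (scaling_vertices sub) vE image_setU !image_set1.
  - rewrite pE (scaling_midpoint sg) -?pE //; exact: face_sub eE.1 _ _.
apply: (equidistant_eq0 hQ dQ nQ) => u v uQ vQ.
have [g sg <-] := isoQ _ _ uQ vQ.
rewrite (barycentre_equidistant (P := Q) (g := g)) //; last exact: vertices_sub.
apply/seteqP; split; first exact: gT.
have [g' [sg' _ gK]] := scaling_inv sg; rewrite invr1 in sg'.
move=> p Tp; exists (g' p); last by rewrite gK //; exact: TQ.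
by apply: (gT _ sg'); exists p.
Qed.

Section Flag.
Variables (n k : nat) (P : set 'rV[R]_n) (F : nat -> set 'rV[R]_n) (t : R).
Hypotheses (mP : midscribed k P t) (fF : flag k P F).

Let hP := mid_hull mP.
Let dP := mid_dim mP.
Let k2 := mid_ge2 mP.
Let HP := mid_homogeneous mP.
Let nP := mid_norm mP.
Let eP := mid_edge mP.
Local Notation c := (center P).
Local Notation rho := (Num.sqrt (1 - dot c c)).

Lemma flag_top : F k = P. Proof. by case: fF. Qed.

Lemma inradius_gt0 : 0 < rho.
Proof.
rewrite sqrtr_gt0 subr_gt0 -flag_top.
exact: (flag_center_lt1 mP fF k2).
Qed.

Lemma inradius_sqr : rho ^+ 2 = 1 - dot c c.
Proof. by rewrite sqr_sqrtr // ltW // -sqrtr_gt0 inradius_gt0. Qed.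

Lemma center_top x : P x -> dot c x = dot c c.
Proof.
move=> Px; rewrite -flag_top.
by apply: (flag_center_dot mP fF) => //; rewrite flag_top.
Qed.

(** Comparing circumradii and edge lengths of [P] and [Q]: a similarity with
    ratio [r] turns the circumradius [rho^2 + t^2] into [1 + t'^2] and the
    half-edge [t] into [t' = r t], so that [r rho = 1]. *)
Lemma canonical_edge_length r (Q : set 'rV[R]_k) (chi : 'rV[R]_n -> 'rV[R]_k) e u v :
  scaling r P Q chi -> is_hull Q -> has_dim Q k -> edge_scribed Q ->
  edge Q e -> vertices e = [set u; v] -> u != v -> edist u v / 2 = t / rho.
Proof.
move=> sP hQ dQ tQ eE vE uv; have HQ := homogeneous_scaling sP HP.
have [t' [_ _ _ _ t'0 nQ eQ]] := edge_scribed_midscribed hQ dQ k2 tQ HQ.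
have [-> _] := eQ _ _ _ eE vE uv.
have [e' fe' e'E] := scaling_kface_inv sP eE.
have [u' [v' [uv' vE' _]]] := edge_segment (face_hull hP fe'.1) fe'.2.
have Pe' := face_sub fe'.1.
have e'u : e' u' by apply: vertices_sub; rewrite vE'; left.
have e'v : e' v' by apply: vertices_sub; rewrite vE'; right.
have se := scaling_sub sP Pe'; rewrite e'E in se.
have [r0 rE PQ] := sP.
have rt : t' = r * t.
  have [l _] := eP fe' vE' uv'.
  have vE2 : vertices e = [set chi u'; chi v'].
    by rewrite (scaling_vertices se) vE' image_setU !image_set1.
  have [|l' _] := eQ _ _ _ eE vE2.
    by apply: contra uv' => /eqP /(scaling_inj se e'u e'v) ->.
  by move: l'; rewrite rE ?l; [lra|exact: Pe'|exact: Pe'].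
have isoQ : isogonal Q by case: (HQ _ _ k2 (conj (face_refl Q) dQ)).
have cQ0 : barycentre (vertices Q) = 0.
  by apply: (equidistant_eq0 hQ dQ nQ) => x y; exact: isogonal_equidistant.
have E : 1 + t' ^+ 2 = r ^+ 2 * (rho ^+ 2 + t ^+ 2).
  apply: (circumradius_scaling (A := vertices P) _ _ _ sP).
  - exact: finite_vertices.
  - have [x xP] := hull_vertex hP (has_dim_inhabited dP); by exists x.
  - exact: vertices_sub.
  - move=> x xP; rewrite -/(center P) edist_sqr inradius_sqr.
    have := center_top (vertices_sub xP); rewrite !dotDl !dotDr !dotNl !dotNr.
    by rewrite (dotC x c) (nP xP); lra.
  - move=> x xP; rewrite -(scaling_vertices sP) cQ0 edist_sqr sub0r dotNl dotNr opprK.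
    by apply: nQ; rewrite (scaling_vertices sP); exists x.
have rr : r * rho = 1.
  apply: eqr_sqr; rewrite ?ler01 ?mulr_ge0 ?ltW ?inradius_gt0 //.
  by move: E; rewrite rt !exprMn expr1n; lra.
rewrite rt; have rho0 := lt0r_neq0 inradius_gt0.
rewrite mulrAC mulfV ?pnatr_eq0 // mul1r; apply: (canRL (mulfK rho0)).
by rewrite mulrAC rr mul1r.
Qed.

(** The gaps of the flag form an orthogonal basis of the direction of [P];
    coordinates in the normalised basis, centred and divided by [rho], embed
    [P] isometrically up to scale with edges tangent to the unit sphere. *)
Lemma canonical_copy : exists r (Q : set 'rV[R]_k) (chi : 'rV[R]_n -> 'rV[R]_k),
  [/\ scaling r P Q chi, is_hull Q, has_dim Q k & Defs.canonical Q].
Proof.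
pose E := frame F k.
have EE : E *m E^T = 1%:M := frame_orthonormal mP fF.
have PE x : P x -> (x - c <= E)%MS.
  move=> Px; rewrite -flag_top.
  exact: (frame_span mP fF Px).
have rho0 := inradius_gt0; have rhon := lt0r_neq0 rho0.
pose chi x := (x - c) *m (rho^-1 *: E^T).
have chi_dot x y z : P x -> P y -> P z ->
    dot (chi x) (chi y - chi z) = rho^-1 ^+ 2 * dot (x - c) (y - z).
  move=> Px Py Pz; rewrite /chi -!scalemxAr -scalerBr -mulmxBl (dotZl rho^-1) (dotZr rho^-1).
  have -> : y - c - (z - c) = y - z by rewrite opprB addrA subrK.
  rewrite (orthonormal_dot EE) ?PE //; first by ring.
  have -> : y - z = (y - c) - (z - c) by rewrite opprB addrA subrK.
  by rewrite addmx_sub ?eqmx_opp ?PE.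
have sP : scaling rho^-1 P (chi @` P) chi.
  split=> //; first by rewrite invr_gt0.
  move=> x y Px Py; apply: eqr_sqr; rewrite ?mulr_ge0 ?edist_ge0 ?invr_ge0 ?ltW //.
  rewrite exprMn !edist_sqr [in LHS]dotDl [in LHS]dotNl !chi_dot // -mulrBr.
  congr (_ * _); rewrite -dotNl -dotDl; congr (dot _ _).
  by rewrite opprB addrA subrK.
have hQ : is_hull (chi @` P) by exact: is_hull_affine.
have dQ := scaling_dim sP dP.
exists rho^-1, (chi @` P), chi; split=> //.
apply: midscribed_canonical => //; last exact: homogeneous_scaling sP HP.
move=> e' /(scaling_kface_inv sP)[e eE <-].
have [u [v [uv vE _]]] := edge_segment (face_hull hP eE.1) eE.2.
have [_ /(_ (2^-1 *: (u + v)))[_ /(_ erefl) tp]] := eP eE vE uv.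
have [ep np tE] := tp; have eS := face_sub eE.1.
set p := 2^-1 *: (u + v) in ep np tE.
have Pp := eS _ ep.
have chic : chi p = chi p - 0 by rewrite subr0.
exists (chi p); split; first by exists p.
  apply: eqr_sqr; rewrite ?enorm_ge0 ?ler01 // enorm_sqr expr1n.
  rewrite /chi -!scalemxAr (dotZl rho^-1) (dotZr rho^-1) (orthonormal_dot EE) ?PE //.
  have := center_top Pp; rewrite dotDl !dotDr !dotNl !dotNr (dotC p c).
  have -> : dot p p = 1 by rewrite -enorm_sqr np expr1n.
  move=> ->; rewrite (_ : 1 + _ + _ = rho ^+ 2); last by rewrite inradius_sqr; ring.
  by field.
move=> _ [x ex <-]; have Px := eS _ ex.
rewrite chi_dot // dotDl tE // dotNl dotDr dotNr.
by rewrite (center_top Px) (center_top Pp) subrr oppr0 addr0 mulr0.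
Qed.

Lemma canonical_lengthE m r (P1 : set 'rV[R]_m) (phi : 'rV[R]_m -> 'rV[R]_n) :
  is_hull P1 -> scaling r P1 P phi -> canonical_length k P1 = t / rho.
Proof.
move=> hP1 sphi; have [x xP] := has_dim_inhabited dP.
have [psi [spsi _ _]] := scaling_inv sphi.
have P10 : P1 !=set0.
  by case: sphi => _ _ PE; move: xP; rewrite -PE => -[y Py _]; exists y.
rewrite /canonical_length; case: xgetP => [l _ [Q [chi [[[hQ dQ] _ [tQ _] sQ] lE]]]|].
  have /similar_scaling[s sQ'] := sQ.
  have sPQ := scaling_comp spsi sQ'.
  have [v vQ] := hull_vertex hQ (has_dim_inhabited dQ).
  have [e [w [eE vw vE]]] := edge_at hQ dQ (ltnW k2) vQ.
  rewrite (lE e v w eE) ?vE //; [|by left|by right].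
  exact: canonical_edge_length sPQ hQ dQ tQ eE vE vw.
have [s [Q [chi [sQ hQ dQ cQ]]]] := canonical_copy.
have sP1 := scaling_comp sphi sQ.
move/(_ (t / rho)); case; exists Q, (chi \o phi); split.
  split=> //; first exact: scaling_comb_equiv hP1 P10 sP1.
  by apply/similar_scaling; exists (s * r).
move=> e u v eE eu ev uv.
have [u' [v' [uv' vE _]]] := edge_segment (face_hull hQ eE.1) eE.2.
have vE' : vertices e = [set u; v].
  move: eu ev uv; rewrite vE => -[/= ->|/= ->] [/= ->|/= ->] //; rewrite ?eqxx //.
  by rewrite setUC.
by rewrite (canonical_edge_length sQ hQ dQ cQ.1 eE vE' uv).
Qed.

End Flag.

End CanonicalLength.

(** * Spheres and bends *)

Section Bends.
Variable R : realType.
Implicit Types d : nat.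

Lemma edist_le_sqr d (x y : 'rV[R]_d) r : 0 < r ->
  (edist x y <= r) = (dot (x - y) (x - y) <= r ^+ 2).
Proof. by move=> r0; rewrite -edist_sqr ler_sqr ?nnegrE ?edist_ge0 // ltW. Qed.

Lemma edist_ge_sqr d (x y : 'rV[R]_d) r : 0 < r ->
  (r <= edist x y) = (r ^+ 2 <= dot (x - y) (x - y)).
Proof. by move=> r0; rewrite -edist_sqr ler_sqr ?nnegrE ?edist_ge0 // ltW. Qed.

Lemma unit_vector d : (0 < d)%N -> exists e : 'rV[R]_d, dot e e = 1.
Proof.
case: d => // d _; exists (delta_mx 0 0).
rewrite /dot (bigD1 ord0) //= !mxE eqxx mulr1 big1 ?addr0 // => i /negbTE i0.
by rewrite !mxE i0 andbF mulr0.
Qed.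

(** Parallelogram law: the squared distances from [c'] to the two points have mean
    [dot (c - c') (c - c') + s ^+ 2]. *)
Lemma diameter_le d (c c' e : 'rV[R]_d) (s r : R) : dot e e = 1 -> 0 <= r -> 0 <= s ->
  dot (c + s *: e - c') (c + s *: e - c') <= r ^+ 2 ->
  dot (c - s *: e - c') (c - s *: e - c') <= r ^+ 2 -> s <= r.
Proof.
move=> ee r0 s0 h1 h2; rewrite -ler_sqr ?nnegrE //.
move: h1 h2 (dot_ge0 (c - c')); rewrite !dotE ee.
rewrite ?(dotC c' c) ?(dotC e c) ?(dotC e c'); lra.
Qed.

(** The three kinds of spheres are told apart by the point at infinity and by the
    boundedness of the complement; [bend] is thus well defined. In dimension 0 it
    is not: every ball is the whole space. *)
Lemma has_bend_uniq d (S : set (ext R d)) b b' : (0 < d)%N ->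
  has_bend S b -> has_bend S b' -> b = b'.
Proof.
move=> /unit_vector [e ee].
have ball_le c r c' r' : 0 < r -> 0 < r' ->
    (forall x : 'rV[R]_d, edist x c <= r -> edist x c' <= r') -> r <= r'.
  move=> r0 r'0 sub; apply: (diameter_le (c := c) (c' := c') ee (ltW r'0) (ltW r0)).
    rewrite -edist_le_sqr //; apply: sub; rewrite edist_le_sqr // addrC addKr.
    by rewrite !dotE ee; lra.
  rewrite -edist_le_sqr //; apply: sub; rewrite edist_le_sqr // [c - _]addrC addrK.
  by rewrite !dotE ee; lra.
have ext_le c r c' r' : 0 < r -> 0 < r' ->
    (forall x : 'rV[R]_d, r' <= edist x c' -> r <= edist x c) -> r <= r'.
  move=> r0 r'0 sub; rewrite leNgt; apply/negP => rr'.
  (* The complements are open balls: their diameters are only approached. *)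
  pose s := (r + r') / 2; have s0 : 0 < s by rewrite /s; lra.
  have sub' x : edist x c < r -> edist x c' < r'.
    by rewrite !ltNge; apply: contra; exact: sub.
  suff : s <= r' by rewrite /s; lra.
  have lt x : dot (x - c) (x - c) = s ^+ 2 -> edist x c < r.
    by move=> xs; rewrite ltNge edist_ge_sqr // xs -ltNge ltr_sqr ?nnegrE ?ltW // /s; lra.
  apply: (diameter_le (c := c) (c' := c') ee (ltW r'0) (ltW s0)).
    rewrite -edist_le_sqr // ltW // sub' // lt // addrC addKr.
    by rewrite !dotE ee; ring.
  rewrite -edist_le_sqr // ltW // sub' // lt // [c - _]addrC addrK.
  by rewrite !dotE ee; ring.
have half (c a : 'rV[R]_d) r t : 0 < r -> a != 0 ->
    ~ (forall x : 'rV[R]_d, (r <= edist x c) <-> (dot a x <= t)).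
  move=> r0 a0 E; have aa : 0 < dot a a by rewrite dot_gt0.
  (* The points [x0] and [x0 + l *: a] outside the half-space are at distance
     [2 * r], so no open ball of radius [r] contains both. *)
  pose x0 := ((t + 1) / dot a a) *: a; pose l := 2 * r / enorm a.
  have far x : t < dot a x -> dot (x - c) (x - c) < r ^+ 2.
    by move=> h; rewrite ltNge -edist_ge_sqr //; apply/negP => /E; rewrite leNgt h.
  have x0t : dot a x0 = t + 1 by rewrite dotZr divfK ?gt_eqF.
  have na : 0 < enorm a by rewrite lt0r enorm_ge0 andbT -sqrf_eq0 enorm_sqr gt_eqF.
  have l0 : 0 < l by rewrite divr_gt0 // mulr_gt0.
  have h0 : dot (x0 - c) (x0 - c) < r ^+ 2 by apply: far; rewrite x0t; lra.
  have h1 : dot (x0 + l *: a - c) (x0 + l *: a - c) < r ^+ 2.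
    by apply: far; rewrite dotDr x0t dotZr; have := mulr_gt0 l0 aa; lra.
  have la : l * (l * dot a a) = 4 * r ^+ 2.
    by rewrite -enorm_sqr /l; field; rewrite gt_eqF.
  have := dot_ge0 (2 *: (x0 - c) + l *: a).
  have : dot (x0 + l *: a - c) (x0 + l *: a - c) =
      dot (x0 - c) (x0 - c) + 2 * l * dot (x0 - c) a + 4 * r ^+ 2.
    rewrite -la; move: (x0) => y; rewrite !dotE (dotC a y) (dotC c y) (dotC a c); ring.
  have : dot (2 *: (x0 - c) + l *: a) (2 *: (x0 - c) + l *: a) =
      4 * dot (x0 - c) (x0 - c) + 4 * l * dot (x0 - c) a + 4 * r ^+ 2.
    rewrite -la; move: (x0) => y; rewrite !dotE (dotC a y) (dotC c y) (dotC a c); ring.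
  by lra.
have ball0 (X : set 'rV[R]_d) : ~ (Some @` X) None by case.
have some1 (X Y : set 'rV[R]_d) : Some @` X = Some @` Y -> forall x, X x <-> Y x.
  move=> XY x; split=> Xx; have : (Some @` X) (Some x).
  - by exists x.
  - by rewrite XY => -[y Yy [<-]].
  - by rewrite XY; exists x.
  - by case=> y Yy [<-].
have some2 (X Y : set 'rV[R]_d) :
    None |` Some @` X = None |` Some @` Y -> forall x, X x <-> Y x.
  move=> XY x; split=> Xx; have : (None |` Some @` X) (Some x).
  - by right; exists x.
  - by rewrite XY => -[//|[y Yy [<-]]].
  - by rewrite XY; right; exists x.
  - by case=> // -[y Yy [<-]].
have none (X Y : set 'rV[R]_d) : Some @` X <> None |` Some @` Y.
  by move=> XY; apply: (ball0 X); rewrite XY; left.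
case=> [[c [r [r0 -> SE]]]|[c [r [r0 -> SE]]]|[-> [a [t [a0 SE]]]]];
case=> [[c' [r' [r'0 -> SE']]]|[c' [r' [r'0 -> SE']]]|[-> [a' [t' [a'0 SE']]]]] //;
  rewrite {}SE in SE'.
- have E := some1 _ _ SE'; congr (_^-1); apply/le_anti/andP; split.
    by apply: (ball_le c r c' r') => // x /E.
  by apply: (ball_le c' r' c r) => // x /E.
- by case: (none _ _ SE').
- by case: (none _ _ SE').
- by case: (none _ _ (esym SE')).
- have E := some2 _ _ SE'; congr (- _^-1); apply/le_anti/andP; split.
    by apply: (ext_le c r c' r') => // x /E.
  by apply: (ext_le c' r' c r) => // x /E.
- by case: (half c a' r t' r0 a'0); exact: some2 SE'.
- by case: (none _ _ (esym SE')).
- by case: (half c' a r' t r'0 a0); exact: some2 (esym SE').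
Qed.

Lemma bendE d (S : set (ext R d)) b : (0 < d)%N -> has_bend S b -> bend S = b.
Proof.
move=> d0 Sb; rewrite /bend; case: xgetP => [b' _ /(has_bend_uniq d0 Sb) ->//|].
by move/(_ b).
Qed.

(** The sphere with coordinates [(A, B, C)]: these represent spheres by vectors of
    Lorentzian norm 1, the quadratic form being [dot B B - A * C]. *)
Definition quadric d (A : R) (B : 'rV[R]_d) (C : R) : set (ext R d) :=
  [set x | if x is Some y then A * dot y y - 2 * dot B y + C <= 0 else A <= 0].

(** Completing the square: if [A != 0] the centre is [A^-1 *: B] and the squared
    radius is [A ^- 2] by the normalisation of the coordinates. *)
Lemma quadric_bend d (A : R) (B : 'rV[R]_d) (C : R) :
  dot B B - A * C = 1 -> has_bend (quadric A B C) A.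
Proof.
move=> BAC.
have sq (y : 'rV[R]_d) : A != 0 -> dot (y - A^-1 *: B) (y - A^-1 *: B)
    = A^-1 ^+ 2 + A^-1 * (A * dot y y - 2 * dot B y + C).
  move=> A0; have -> : dot (y - A^-1 *: B) (y - A^-1 *: B) =
      dot y y - 2 * A^-1 * dot B y + A^-1 ^+ 2 * dot B B.
    by rewrite !dotE (dotC y B); ring.
  by rewrite (_ : dot B B = 1 + A * C); [field|lra].
have [A0|A0|A0] := ltgtP A 0.
- apply: Or32; have Ai : A^-1 < 0 by rewrite invr_lt0.
  exists (A^-1 *: B), (- A^-1); split; [by lra|by rewrite invrN invrK opprK|].
  apply/seteqP; split=> [[y|] /= h|[y|] /=]; last by rewrite ltW.
  + right; exists y => //=; rewrite edist_ge_sqr; last by lra.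
    by rewrite sq ?lt_eqF // sqrrN lerDl nmulr_rge0.
  + by left.
  + case=> // -[z /= h [<-]]; move: h; rewrite edist_ge_sqr; last by lra.
    by rewrite sq ?lt_eqF // sqrrN lerDl nmulr_rge0.
- apply: Or31; have Ai : 0 < A^-1 by rewrite invr_gt0.
  exists (A^-1 *: B), A^-1; split; [by []|by rewrite invrK|].
  apply/seteqP; split=> [[y|] /= h|_ [y /= h <-]] /=.
  + exists y => //=; rewrite edist_le_sqr //.
    by rewrite sq ?gt_eqF // gerDl pmulr_rle0.
  + by move: A0; rewrite ltNge h.
  + by move: h; rewrite edist_le_sqr // sq ?gt_eqF // gerDl pmulr_rle0.
- apply: Or33; split=> //; exists (- 2 *: B), (- C); split.
    rewrite scaler_eq0 negb_or oppr_eq0 pnatr_eq0 /= -dot_eq0.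
    by move: BAC; rewrite A0 mul0r subr0 => ->; exact: oner_neq0.
  apply/seteqP; split=> [[y|] /= h|[y|] /=]; last by rewrite A0.
  + by right; exists y => //=; move: h; rewrite dotZl A0; lra.
  + by left.
  + by case=> // -[z /= h [<-]]; move: h; rewrite dotZl A0; lra.
Qed.

End Bends.

(** * Moebius transformations *)

Section Mobius.
Variable R : realType.
Implicit Types d : nat.

Lemma image_involution T (f : T -> T) (A : set T) :
  (forall x, f (f x) = x) -> f @` A = [set x | A (f x)].
Proof.
move=> fK; apply/seteqP; split=> [_ [x Ax <-] /=|x Ax]; first by rewrite fK.
by exists (f x).
Qed.

Lemma inversionK d (c : 'rV[R]_d) r x : 0 < r ->
  inversion c r (inversion c r x) = x.
Proof.
move=> r0; case: x => [y|] /=; last by rewrite eqxx.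
have [->//|yc] := eqVneq y c.
have D : dot (y - c) (y - c) != 0 by rewrite dot_eq0 subr_eq0.
have k0 : r ^+ 2 / edist y c ^+ 2 != 0.
  by rewrite edist_sqr mulf_neq0 ?invr_neq0 // sqrf_eq0 gt_eqF.
rewrite /= -subr_eq0 addrAC subrr add0r scaler_eq0 (negbTE k0) subr_eq0 (negbTE yc) /=.
congr Some; rewrite !edist_sqr.
have E k : c + k *: (y - c) - c = k *: (y - c) by rewrite addrC addKr.
rewrite E scalerA dotZl dotZr (_ : _ / _ * _ = 1) ?scale1r ?[c + _]addrC ?subrK //.
by field; rewrite D gt_eqF.
Qed.

(** In coordinates centred at [c], inversion exchanges the outer coefficients [A]
    and [C] up to the factor [r ^+ 2]. *)
Lemma inversion_quadric d (c : 'rV[R]_d) r A B C A' : 0 < r ->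
  A' = (A * dot c c - 2 * dot B c + C) / r ^+ 2 ->
  inversion c r @` quadric A B C
    = quadric A' (B - (A - A') *: c)
        (A * r ^+ 2 + 2 * dot B c - 2 * A * dot c c + A' * dot c c).
Proof.
move=> r0 A'E; have rr : 0 < r ^+ 2 by rewrite exprn_gt0.
rewrite image_involution; last by move=> x; exact: inversionK.
apply/seteqP; suff E x : quadric A B C (inversion c r x) <->
    quadric A' (B - (A - A') *: c)
        (A * r ^+ 2 + 2 * dot B c - 2 * A * dot c c + A' * dot c c) x.
  by split=> x /= /E.
case: x => [y|] /=; last by rewrite A'E pmulr_lle0 ?invr_gt0.
have [->|yc] := eqVneq y c; rewrite /=.
  rewrite (_ : _ + _ = A * r ^+ 2) ?pmulr_lle0 //.
  by rewrite !dotE; ring.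
have D : 0 < dot (y - c) (y - c) by rewrite dot_gt0 subr_eq0.
set k := r ^+ 2 / _; have k0 : 0 < k by rewrite divr_gt0 // edist_sqr.
have kD : k * dot (y - c) (y - c) = r ^+ 2 by rewrite /k edist_sqr divfK ?gt_eqF.
have A'r : A' * r ^+ 2 = A * dot c c - 2 * dot B c + C.
  by rewrite A'E divfK // gt_eqF.
rewrite (_ : A * _ - _ + _ = k * (A' * dot y y - 2 * dot (B - (A - A') *: c) y +
   (A * r ^+ 2 + 2 * dot B c - 2 * A * dot c c + A' * dot c c))).
  by rewrite pmulr_rle0.
rewrite (_ : C = A' * r ^+ 2 - A * dot c c + 2 * dot B c); last by rewrite A'r; ring.
rewrite -kD !dotE (dotC y c); ring.
Qed.

Lemma reflectionK d (a : 'rV[R]_d) t x : a != 0 ->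
  reflection a t (reflection a t x) = x.
Proof.
move=> a0; have aa : dot a a != 0 by rewrite dot_eq0.
case: x => [y|//] /=; congr Some; set k := 2 * (dot a y - t) / dot a a.
rewrite (_ : 2 * _ / _ = - k) ?scaleNr ?opprK ?subrK //.
by rewrite /k !dotE; field.
Qed.

Lemma reflection_quadric d (a : 'rV[R]_d) t A B C : a != 0 ->
  reflection a t @` quadric A B C
    = quadric A (B + (2 * (A * t - dot B a) / dot a a) *: a)
        (C + 4 * t * (t * A - dot B a) / dot a a).
Proof.
move=> a0; have aa : dot a a != 0 by rewrite dot_eq0.
rewrite image_involution; last by move=> x; exact: reflectionK.
apply/seteqP; suff E x : quadric A B C (reflection a t x) <->
    quadric A (B + (2 * (A * t - dot B a) / dot a a) *: a)
        (C + 4 * t * (t * A - dot B a) / dot a a) x.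
  by split=> x /= /E.
case: x => [y|//] /=.
rewrite (_ : A * _ - _ + _ = A * dot y y -
  2 * dot (B + (2 * (A * t - dot B a) / dot a a) *: a) y +
  (C + 4 * t * (t * A - dot B a) / dot a a)) //.
by rewrite !dotE (dotC y a); field.
Qed.

(** Moebius transformations act linearly on the coordinates of spheres and
    preserve the quadratic form, hence also its dual form
    [dot q q - 4 * p * s] on linear functionals: isotropic functionals pull back
    to isotropic functionals. *)
Lemma mobius_quadric d (mu : ext R d -> ext R d) : mobius mu ->
  forall (p : R) (q : 'rV[R]_d) (s : R), dot q q = 4 * p * s ->
  exists p' q' s', dot q' q' = 4 * p' * s' /\
    forall A B C, dot B B - A * C = 1 -> exists A' B' C',
      [/\ dot B' B' - A' * C' = 1, mu @` quadric A B C = quadric A' B' C' &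
          p * A' + dot q B' + s * C' = p' * A + dot q' B + s' * C].
Proof.
elim=> {mu} [|c r g r0 _ IH|a t g a0 _ IH] p q s pqs.
- by exists p, q, s; split=> // A B C BAC; exists A, B, C; rewrite image_id.
(* The new functional is the pullback of [(p, q, s)] under the linear map of
   [inversion_quadric], and below under that of [reflection_quadric]. *)
- pose w := (r ^+ 2)^-1; pose k := p + dot q c + s * dot c c.
  have r2 : r ^+ 2 != 0 by rewrite expf_neq0 // gt_eqF.
  have r0' : r != 0 by rewrite gt_eqF.
  have [|p' [q' [s' [pqs' H]]]] := IH
    (k * w * dot c c - dot q c + s * r ^+ 2 - 2 * s * dot c c)
    (q + (2 * s - 2 * w * k) *: c) (k * w).
    rewrite !dotE (dotC c q).
    have -> : dot q q = 4 * p * s by [].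
    by rewrite /k /w; field.
  exists p', q', s'; split=> // A B C /H [A' [B' [C' [BAC' gE <-]]]].
  pose A'' := (A' * dot c c - 2 * dot B' c + C') / r ^+ 2.
  exists A'', (B' - (A' - A'') *: c),
    (A' * r ^+ 2 + 2 * dot B' c - 2 * A' * dot c c + A'' * dot c c); split.
  + rewrite -[RHS]BAC' !dotE (dotC c B') /A''; field.
    by [].
  + by rewrite -(inversion_quadric (A' := A'') r0 erefl) -gE image_comp.
  + by rewrite !dotE (dotC c B') /A'' /k /w; field.
- have aa : dot a a != 0 by rewrite dot_eq0.
  have [|p' [q' [s' [pqs' H]]]] := IH
    (p + 2 * t * dot q a / dot a a + 4 * s * t ^+ 2 / dot a a)
    (q - (2 * dot q a / dot a a + 4 * s * t / dot a a) *: a) s.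
    rewrite !dotE (dotC a q).
    have -> : dot q q = 4 * p * s by [].
    by field.
  exists p', q', s'; split=> // A B C /H [A' [B' [C' [BAC' gE <-]]]].
  exists A', (B' + (2 * (A' * t - dot B' a) / dot a a) *: a),
    (C' + 4 * t * (t * A' - dot B' a) / dot a a); split.
  + by rewrite -[RHS]BAC' !dotE (dotC a B'); field.
  + by rewrite -(reflection_quadric _ _ _ _ a0) -gE image_comp.
  + by rewrite !dotE (dotC a B'); field.
Qed.

Definition equator d (v : 'rV[R]_d.+1) : 'rV[R]_d := \row_j v 0 (lift ord_max j).

Definition with_height d (y : 'rV[R]_d) (h : R) : 'rV[R]_d.+1 :=
  \row_i oapp (y 0) h (unlift ord_max i).

Lemma dot_equator d (u v : 'rV[R]_d.+1) :
  dot u v = u 0 ord_max * v 0 ord_max + dot (equator u) (equator v).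
Proof.
rewrite /dot (bigD1_ord ord_max) //=; congr (_ + _); apply: eq_bigr => j _.
by rewrite !mxE.
Qed.

Lemma with_height_max d (y : 'rV[R]_d) h : with_height y h 0 ord_max = h.
Proof. by rewrite mxE unlift_none. Qed.

Lemma equator_with_height d (y : 'rV[R]_d) h : equator (with_height y h) = y.
Proof. by apply/rowP => j; rewrite !mxE liftK. Qed.

Lemma stereoE d (u : 'rV[R]_d.+1) : u 0 ord_max != 1 ->
  stereo u = Some ((1 - u 0 ord_max)^-1 *: equator u).
Proof.
move=> /negbTE u1; rewrite /stereo u1; congr Some.
by apply/rowP => j; rewrite !mxE mulrC.
Qed.

(** Substituting stereographic coordinates into [1 <= dot u v]. *)
Lemma stereo_sphere_quadric d (v : 'rV[R]_d.+1) t : 0 < t ->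
  stereo_sphere v = quadric ((1 - v 0 ord_max) / t) (t^-1 *: equator v)
    ((1 + v 0 ord_max) / t).
Proof.
move=> t0; set vn := v 0 ord_max.
have scale (y : 'rV[R]_d) : (1 - vn) / t * dot y y - 2 * dot (t^-1 *: equator v) y
     + (1 + vn) / t = t^-1 * ((1 - vn) * dot y y - 2 * dot (equator v) y + (1 + vn)).
  by rewrite dotZl; ring.
have ti : 0 < t^-1 by rewrite invr_gt0.
apply/seteqP; split=> [_ [u [/= nu uv] <-]|].
  have uu : u 0 ord_max ^+ 2 + dot (equator u) (equator u) = 1.
    by rewrite expr2 -dot_equator -enorm_sqr nu expr1n.
  have [u1|u1] := eqVneq (u 0 ord_max) 1.
    rewrite /stereo u1 eqxx /= pmulr_lle0 // subr_le0.
    have e0 : equator u = 0.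
      by apply/eqP; rewrite -dot_eq0; move: uu; rewrite u1; lra.
    by move: uv; rewrite dot_equator u1 e0 dot0l mul1r addr0.
  rewrite (stereoE u1) /= scale pmulr_rle0 // dotZl !dotZr.
  set un := u 0 ord_max in uu u1 *.
  have un1 : 0 < 1 - un.
    rewrite subr_gt0 lt_neqAle u1 /=; have := dot_ge0 (equator u) => h.
    have : un ^+ 2 <= 1 by lra.
    by move=> h1; rewrite leNgt; apply/negP => h2; nra.
  have -> : dot (equator u) (equator u) = 1 - un ^+ 2 by lra.
  rewrite -(pmulr_rle0 _ un1).
  rewrite [leLHS](_ : _ = 2 * (1 - dot u v)); first by lra.
  by rewrite dot_equator -/un -/vn (dotC (equator v)); field; rewrite gt_eqF.
case=> [y|] /=.
  rewrite scale pmulr_rle0 // => H; pose D := dot y y + 1.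
  have D0 : 0 < D by rewrite /D; have := dot_ge0 y; lra.
  have Dn : D != 0 by rewrite gt_eqF.
  (* The inverse of stereographic projection. *)
  exists (with_height ((2 / D) *: y) ((dot y y - 1) / D)).
    split=> /=.
      apply/eqP; rewrite -(eqrXn2 (n := 2)) ?enorm_ge0 // expr1n enorm_sqr.
      rewrite dot_equator with_height_max equator_with_height dotZl dotZr.
      by apply/eqP; rewrite /D; field; rewrite -/D.
    rewrite dot_equator with_height_max equator_with_height dotZl -/vn.
    rewrite -(ler_pM2l D0) (_ : D * (_ + _) = (dot y y - 1) * vn + 2 * dot y (equator v)).
      by move: H; rewrite (dotC y) /D; lra.
    by field.
  rewrite stereoE with_height_max ?equator_with_height; last first.
    by apply/eqP => /(canRL (mulfVK Dn)); rewrite /D; lra.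
  rewrite scalerA (_ : _ * _ = 1) ?scale1r //; rewrite /D; field.
  by rewrite -/D Dn /=; apply/eqP; rewrite /D; lra.
rewrite pmulr_lle0 // subr_le0 => vn1.
exists (with_height 0 1); last by rewrite /stereo with_height_max eqxx.
split=> /=; last by rewrite dot_equator with_height_max equator_with_height dot0l mul1r addr0.
apply/eqP; rewrite -(eqrXn2 (n := 2)) ?enorm_ge0 // expr1n enorm_sqr.
by rewrite dot_equator with_height_max equator_with_height dot0l mul1r addr0.
Qed.

(** The bend being an isotropic functional of the coordinates, it stays isotropic
    after pulling back by [mu] and by the map, linear in [(v, 1)], that sends [v] to
    the coordinates of its stereographic sphere. *)
Lemma packing_bend d (mu : ext R d -> ext R d) : (0 < d)%N -> mobius mu ->
  exists (alpha : 'rV[R]_d.+1) (beta : R), dot alpha alpha = beta ^+ 2 /\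
    forall v t, 0 < t -> dot v v = 1 + t ^+ 2 ->
      bend (mu @` stereo_sphere v) = (dot alpha v + beta) / t.
Proof.
move=> d0 /mobius_quadric /(_ 1 0 0) [|p [q [s [pqs H]]]].
  by rewrite dot0l mulr0.
exists (with_height q (s - p)), (p + s); split.
  by rewrite dot_equator with_height_max equator_with_height pqs; ring.
move=> v t t0 vt; have tn : t != 0 by rewrite gt_eqF.
rewrite (stereo_sphere_quadric v t0).
have [|A' [B' [C' [BAC' -> L]]]] := H ((1 - v 0 ord_max) / t) (t^-1 *: equator v)
    ((1 + v 0 ord_max) / t).
  have : dot (equator v) (equator v) = 1 + t ^+ 2 - v 0 ord_max ^+ 2.
    by rewrite -vt dot_equator; ring.
  by rewrite dotZl dotZr => ->; field.
rewrite (bendE d0 (quadric_bend BAC')).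
move: L; rewrite mul1r dot0l mul0r !addr0 => ->.
by rewrite dot_equator with_height_max equator_with_height dotZr; field.
Qed.

End Mobius.

(** * The relation between the curvatures of a flag *)

Section Final.
Variable R : realType.

Lemma midscribed_face n k i (P F : set 'rV[R]_n) t : midscribed k P t ->
  (2 <= i)%N -> kface i P F -> midscribed i F t.
Proof.
move=> mP i2 [fF dF]; have hP := mid_hull mP; split=> //.
- exact: face_hull fF.
- exact: homogeneous_face hP (conj fF dF) (mid_homogeneous mP).
- exact: mid_gt0 mP.
- by move=> v; rewrite (face_vertices hP fF) => -[/(mid_norm mP)].
- move=> e u v eF; apply: (mid_edge mP).
  exact: kface_trans hP (conj fF dF) eF.
Qed.

Lemma flag_truncate n k i (P : set 'rV[R]_n) f : is_hull P -> flag k P f ->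
  (i <= k)%N -> flag i (f i) f.
Proof.
move=> hP fP ik; have [ff fs _] := fP; split=> // j ji.
- have [fj dj] := ff j (leq_trans ji ik); split=> //.
  apply: face_restrict fj _ _; last exact: face_sub (ff i ik).1.
  exact: flag_sub fP _ _ ji ik.
- exact: fs (leq_trans ji ik).
Qed.

Lemma scaling_flag r n m k (P : set 'rV[R]_n) (Q : set 'rV[R]_m)
    (phi : 'rV[R]_n -> 'rV[R]_m) f :
  scaling r P Q phi -> flag k P f -> flag k Q (fun i => phi @` f i).
Proof.
move=> sP [ff fs fk]; split=> [i ik|i ik|].
- exact: scaling_kface sP (ff i ik).
- by apply: image_subset; exact: fs.
- by rewrite fk; case: sP.
Qed.

Lemma parseval n (E : 'M[R]_n) (a : 'rV[R]_n) : E *m E^T = 1%:M ->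
  \sum_(i < n) dot a (row i E) ^+ 2 = dot a a.
Proof.
move=> /mulmx1C EE.
have -> : dot a a = dot (a *m E^T) (a *m E^T).
  by rewrite !dot_mx trmx_mul trmxK mulmxA -(mulmxA a) EE mulmx1.
apply: eq_bigr => i _; rewrite -expr2; congr (_ ^+ 2).
by rewrite mxE; apply: eq_bigr => j _; rewrite !mxE.
Qed.

End Final.

Theorem theorem2 (R : realType) (d : nat) (d_ge2 : (2 <= d)%N)
    (P : set 'rV[R]_d.+1) (P_polytope : polytope d.+1 P)
    (P_uniform : uniform d.+1 P)
    (S : 'rV[R]_d.+1 -> set (ext R d)) (S_packing : polytopal_packing P S)
    (f : nat -> set 'rV[R]_d.+1) (f_flag : flag d.+1 P f) :
  let kappa i := curvature S (f i) in
  let ell i := canonical_length i (f i) in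
  (kappa 0%N - kappa 1%N) ^+ 2
  + ell 2%N ^+ 2 * (kappa 1%N - kappa 2%N) ^+ 2
  + \sum_(2 <= i < d.+1)
      (ell i.+1 ^- 2 - ell i ^- 2)^-1 * (kappa i - kappa i.+1) ^+ 2
  = canonical_length d.+1 P ^+ 2 * curvature S P ^+ 2.
Proof.
move=> kappa ell; have [hP dP] := P_polytope.
have d1_ge2 : (2 <= d.+1)%N := leqW d_ge2.
have HP := uniform_homogeneous d1_ge2 hP dP P_uniform.
have [P0 [phi [mu [[[hP0 dP0] _ [tP0 _] /similar_scaling[r sP]] mobmu SE]]]] := S_packing.
have HP0 := homogeneous_scaling sP HP.
have [t mP0] := edge_scribed_midscribed hP0 dP0 d1_ge2 tP0 HP0.
have t0 := mid_gt0 mP0; have tn := lt0r_neq0 t0.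
pose F i := phi @` f i; have fF : flag d.+1 P0 F := scaling_flag sP f_flag.
have fface i : (i <= d.+1)%N -> kface i P (f i) by case: f_flag => h _ _; exact: h.
have f_top : f d.+1 = P by case: f_flag.
have sf i : (i <= d.+1)%N -> scaling r (f i) (F i) phi.
  by move=> /fface[/face_sub fP _]; exact: scaling_sub sP fP.
pose c i := center (F i).
have [|alpha [beta [ab bendS]]] := packing_bend _ mobmu; first exact: ltnW.
have kappaE i : (i <= d.+1)%N -> kappa i = (dot alpha (c i) + beta) / t.
  move=> ik; have [fi di] := fface i ik; have fin := finite_vertices (face_hull hP fi).
  have v0 : vertices (f i) !=set0.
    have [v vf] := hull_vertex (face_hull hP fi) (has_dim_inhabited di).
    by exists v.
  have N0 := lt0r_neq0 (card_fset_gt0 fin v0).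
  have inj : {in vertices (f i) &, injective phi}.
    move=> x y /set_mem/vertices_sub fx /set_mem/vertices_sub fy.
    exact: scaling_inj (sf i ik) fx fy.
  rewrite /c /center dot_barycentre (scaling_vertices (sf i ik)).
  rewrite sum_fset_image // card_fset_image // /kappa /curvature.
  rewrite (eq_sum_fset (g := fun v => (dot alpha (phi v) + beta) / t)) //.
    rewrite -mulr_suml big_split /= sum_fset_const; field.
    by rewrite tn N0.
  move=> v; rewrite (face_vertices hP fi) => -[vP _]; rewrite SE // (bendS _ t) //.
  by apply: (mid_norm mP0); rewrite (scaling_vertices sP); exists v.
have ellE i : (2 <= i)%N -> (i <= d.+1)%N -> ell i ^+ 2 = t ^+ 2 / (1 - dot (c i) (c i)).
  move=> i2 ik; have mi := midscribed_face mP0 i2 (flag_face fF ik).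
  have fi := flag_truncate hP0 fF ik.
  have hfi := face_hull hP (fface i ik).1.
  rewrite /ell (canonical_lengthE mi fi hfi (sf i ik)) expr_div_n.
  by rewrite (inradius_sqr mi fi).
have c_lt1 i : (2 <= i)%N -> (i <= d.+1)%N -> 1 - dot (c i) (c i) != 0.
  by move=> i2 ik; rewrite gt_eqF // subr_gt0; exact: flag_center_lt1 mP0 fF _ i2 ik.
have c_top : c d.+1 = 0.
  apply: (full_dim_form dP0); have <- : F d.+1 = P0 by case: fF.
  by move=> x y; exact: flag_center_form mP0 fF _ _ _ (leqnn _).
have kgap i : (i < d.+1)%N -> kappa i - kappa i.+1 = dot alpha (gap F i) / t.
  by move=> ik; rewrite !kappaE ?(ltnW ik) // /gap dotDr dotNr -/(c _); field.
have gap_n i : (i < d.+1)%N ->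
    dot (gap F i) (gap F i) = dot (c i) (c i) - dot (c i.+1) (c i.+1).
  exact: gap_sqr mP0 fF _.
have gap_neq0 i : (i < d.+1)%N -> dot (gap F i) (gap F i) != 0.
  by move=> ik; rewrite gt_eqF // (gap_gt0 mP0 fF).
(* The squares of the coordinates of [alpha] in the basis of normalised gaps. *)
pose T i := dot alpha (gap F i) ^+ 2 / dot (gap F i) (gap F i).
have sumT : \sum_(0 <= i < d.+1) T i = dot alpha alpha.
  rewrite -(parseval alpha (frame_orthonormal mP0 fF)) big_mkord.
  apply: eq_bigr => i _; rewrite rowK dotZr /T -enorm_sqr.
  by rewrite exprMn exprVn mulrC.
have c1 : dot (c 1%N) (c 1%N) = 1 := flag_center1 mP0 fF.
have T0 : (kappa 0%N - kappa 1%N) ^+ 2 = T 0%N.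
  have := gap_n 0%N isT; rewrite c1 (flag_center0 mP0 fF) addrAC subrr add0r.
  by move=> gE; rewrite kgap // /T gE expr_div_n.
have T1 : ell 2%N ^+ 2 * (kappa 1%N - kappa 2%N) ^+ 2 = T 1%N.
  have := gap_n 1%N d1_ge2; rewrite c1 => gE.
  rewrite kgap // /T gE ellE //; field.
  by rewrite tn c_lt1.
have Ti i : (2 <= i < d.+1)%N ->
    (ell i.+1 ^- 2 - ell i ^- 2)^-1 * (kappa i - kappa i.+1) ^+ 2 = T i.
  move=> /andP[i2 id]; have gn := gap_neq0 i id; have gE := gap_n i id.
  rewrite gE in gn; rewrite kgap // /T gE !ellE //; try exact: ltnW.
  have h1 := c_lt1 i i2 (ltnW id); have h2 := c_lt1 i.+1 (leqW i2) id.
  rewrite !invf_div; have -> : (1 - dot (c i.+1) (c i.+1)) / t ^+ 2 - (1 - dot (c i) (c i)) / t ^+ 2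
     = (dot (c i) (c i) - dot (c i.+1) (c i.+1)) / t ^+ 2 by ring.
  by field; rewrite tn gn.
have ellP : canonical_length d.+1 P ^+ 2 = t ^+ 2.
  by have := ellE d.+1 d1_ge2 (leqnn _); rewrite c_top dot0l subr0 divr1 /ell f_top.
have kappaP : curvature S P = beta / t.
  by have := kappaE d.+1 (leqnn _); rewrite c_top dot0r add0r /kappa f_top.
rewrite ellP kappaP T0 T1 (eq_big_nat _ _ Ti).
have -> : t ^+ 2 * (beta / t) ^+ 2 = dot alpha alpha by rewrite ab; field.
by rewrite -sumT [RHS]big_ltn // [X in _ = _ + X]big_ltn // addrA.
Qed.
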